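(* Let $E\subset X$ be of finite perimeter. Let $\Gamma$ be the collection of curves $\gamma$ in $X$ such that there exist $t_0,t_1\in[0,\ell_\gamma]$ with $t_0<t_1$ and either (1) $\gamma(t_0)\in\mathcal I(E)$, $\gamma(t_1)\in\mathcal E(E)$ and $\gamma([t_0,t_1])\cap\partial^*E$ is empty, or (2) $\gamma(t_0)\in\mathcal E(E)$, $\gamma(t_1)\in\mathcal I(E)$ and $\gamma([t_0,t_1])\cap\partial^*E$ is empty. Then $\mathrm{Mod}_1(\Gamma)=0$.
   Context: Standing assumptions: $(X,d,\mu)$ is a complete metric space with a Borel regular outer measure $\mu$ that is doubling (there is $C_d\ge 1$ with $0<\mu(B(x,2r))\le C_d\,\mu(B(x,r))<\infty$ for all $x\in X$, $r>0$) and supports a $(1,1)$-Poincaré inequality: there are $C_P>0$, $\lambda\ge 1$ such that for every ball $B(x,r)$, every locally integrable $u$ on $X$ and every upper gradient $g$ of $u$, $\frac{1}{\mu(B(x,r))}\int_{B(x,r)}|u-u_{B(x,r)}|\,d\mu\le C_P\, r\,\frac{1}{\mu(B(x,\lambda r))}\int_{B(x,\lambda r)}g\,d\mu$, where $u_B=\frac1{\mu(B)}\int_B u\,d\mu$. A curve is a rectifiable continuous map from a compact interval into $X$; every curve $\gamma$ is parametrized by arc length, with length $\ell_\gamma$, so it is defined on $[0,\ell_\gamma]$. A nonnegative Borel function $g$ is an upper gradient of an extended real-valued function $u$ if $|u(x)-u(y)|\le\int_\gamma g\,ds$ for all curves $\gamma$ with end points $x,y$ (with $|u(x)-u(y)|=\infty$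 if at least one of the values is infinite). For $u\in L^1_{\mathrm{loc}}(X)$, $\|Du\|(X):=\inf\{\liminf_{i}\int_X g_{u_i}\,d\mu: u_i\in \mathrm{Lip}_{\mathrm{loc}}(X),\ u_i\to u \text{ in } L^1_{\mathrm{loc}}(X)\}$, each $g_{u_i}$ being an upper gradient of $u_i$. A measurable $E\subset X$ is of finite perimeter if $\|D\chi_E\|(X)<\infty$. $\mathcal I(E)$, respectively $\mathcal E(E)$, is the set of $x\in X$ with $\lim_{r\to0^+}\mu(B(x,r)\cap E)/\mu(B(x,r))=1$, respectively $=0$; $\partial^*E$ is the set of points at which both $E$ and $X\setminus E$ have positive upper density, so that $\partial^*E=X\setminus(\mathcal I(E)\cup\mathcal E(E))$. The $1$-modulus of a curve family $\Gamma$ is $\mathrm{Mod}_1(\Gamma):=\inf\int_X\rho\,d\mu$ over all nonnegative Borel $\rho$ on $X$ with $\int_\gamma\rho\,ds\ge1$ for every $\gamma\in\Gamma$. *)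

(* Defs.v *)
From HB Require Import structures.
From mathcomp Require Import all_boot all_order all_algebra.
From mathcomp Require Import all_classical all_reals all_analysis.
From mathcomp Require Import measurable_realfun.

Set Implicit Arguments.
Unset Strict Implicit.
Unset Printing Implicit Defensive.
Import Order.TTheory GRing.Theory Num.Theory.
Import numFieldNormedType.Exports.

Local Open Scope classical_set_scope.
Local Open Scope ring_scope.

(* [Complete] carries a distinguished point, so the space is nonempty. *)
#[short(type="completeMetricType")]
HB.structure Definition CompleteMetric (K : numDomainType) :=
  { M of Metric K M & Complete M }.

Section borel.
Context {R : realType} {X : completeMetricType R}.

Definition borel_type := g_sigma_algebraType [set U : set X | open U].

Definition borel_set (A : set X) := measurable (A : set borel_type).

Definition borel_fun (f : X -> \bar R) :=
  measurable_fun [set: borel_type] (f : borel_type -> \bar R).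

End borel.

Section curves.
Context {R : realType} {X : completeMetricType R}.

Definition path_length (f : R -> X) (a b : R) : \bar R :=
  ereal_sup [set (\sum_(0 <= n < size s)
    mdist (f (nth b (a :: s) n)) (f (nth b (a :: s) n.+1)))%:E
    | s in itv_partition a b].

(* A rectifiable curve in its arc-length parametrization. Only the values of
   [curve_fun] on [0, curve_len] matter; constant curves have length 0. *)
Record curve := Curve {
  curve_len : R ;
  curve_fun :> R -> X ;
  curve_len_ge0 : 0 <= curve_len ;
  curve_continuous : {within `[0, curve_len], continuous curve_fun} ;
  curve_arclength : forall s t, 0 <= s -> s <= t -> t <= curve_len ->
    path_length curve_fun s t = (t - s)%:E }.

Definition curve_integral (c : curve) (g : X -> \bar R) : \bar R :=
  (\int[@lebesgue_measure R]_(t in `[0%R, curve_len c]) g (c t))%E.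

(* In [\bar R], oo - oo is -oo, so `|u x - u y| is +oo as soon as one of the
   two values is infinite. *)
Definition upper_gradient (u g : X -> \bar R) :=
  [/\ borel_fun g, (forall x, 0 <= g x)%E &
    forall c : curve,
      (`|u (c 0%R) - u (c (curve_len c))| <= curve_integral c g)%E].

Definition loc_lipschitz (u : X -> R) :=
  forall x, exists2 r, 0 < r & exists L, forall y z,
    ball x r y -> ball x r z -> `|u y - u z| <= L * mdist y z.

End curves.
Arguments curve {R} X.

Section metric_measure.
Context {R : realType} {X : completeMetricType R}.
Variable mu : {outer_measure set X -> \bar R}.
Local Open Scope ereal_scope.

Definition borel_regular :=
  (forall A, borel_set A -> mu.-caratheodory A) /\
  (forall A, exists B, [/\ borel_set B, A `<=` B & mu B = mu A]).

Definition doubling := exists2 C : R, (1 <= C)%R &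
  forall (x : X) (r : R), (0 < r)%R ->
    [/\ 0 < mu (ball x (2 * r)%R),
        mu (ball x (2 * r)%R) <= C%:E * mu (ball x r) &
        C%:E * mu (ball x r) < +oo].

(* The outer measure restricted to its Caratheodory-measurable sets; all
   integrals with respect to [mu] are taken with respect to it. *)
Definition cara_measure : {measure set (caratheodory_type mu) -> \bar R} :=
  [the measure _ _ of (mu : set (caratheodory_type mu) -> \bar R)].

Definition average (A : set X) (u : X -> \bar R) : \bar R :=
  (mu A)^-1 * \int[cara_measure]_(x in A) u x.

(* "Locally" is read as "on some ball around every point"; complete doubling
   spaces are proper, so this agrees with "on every bounded set". *)
Definition L1loc (u : X -> \bar R) :=
  measurable_fun [set: caratheodory_type mu]
    (u : caratheodory_type mu -> \bar R) /\
  forall x : X, exists2 r : R, (0 < r)%R &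
    \int[cara_measure]_(y in ball x r) `|u y| < +oo.

Definition cvg_L1loc (u_ : nat -> X -> \bar R) (u : X -> \bar R) :=
  forall x : X, exists2 r : R, (0 < r)%R &
    (fun i => \int[cara_measure]_(y in ball x r) `|u_ i y - u y|) @ \oo --> 0.

Definition poincare := exists C lambda : R, [/\ (0 < C)%R, (1 <= lambda)%R &
  forall (x : X) (r : R) (u g : X -> \bar R), (0 < r)%R ->
    L1loc u -> upper_gradient u g ->
    average (ball x r) (fun y => `|u y - average (ball x r) u|) <=
    (C * r)%:E * average (ball x (lambda * r)%R) g].

Definition total_variation (u : X -> \bar R) : \bar R :=
  ereal_inf [set limn_einf (fun i => \int[cara_measure]_x ug.2 i x)
    | ug in [set ug : (nat -> X -> R) * (nat -> X -> \bar R) |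
      [/\ forall i, loc_lipschitz (ug.1 i),
          forall i, upper_gradient (EFin \o ug.1 i) (ug.2 i) &
          cvg_L1loc (fun i => EFin \o ug.1 i) u]]].

Definition finite_perimeter (E : set X) :=
  mu.-caratheodory E /\ total_variation (EFin \o \1_E) < +oo.

Definition density_ratio (E : set X) (x : X) (r : R) : \bar R :=
  mu (ball x r `&` E) / mu (ball x r).

Definition upper_density (E : set X) (x : X) : \bar R :=
  limf_esup (density_ratio E x) 0%R^'+.

Definition meas_interior (E : set X) : set X :=
  [set x | density_ratio E x @ 0%R^'+ --> 1].

Definition meas_exterior (E : set X) : set X :=
  [set x | density_ratio E x @ 0%R^'+ --> 0].

Definition meas_boundary (E : set X) : set X :=
  [set x | 0 < upper_density E x /\ 0 < upper_density (~` E) x].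

Definition modulus1 (Gamma : set (curve X)) : \bar R :=
  ereal_inf [set \int[cara_measure]_x rho x
    | rho in [set rho : X -> \bar R |
      [/\ borel_fun rho, forall x, 0 <= rho x &
          forall c, Gamma c -> 1 <= curve_integral c rho]]].

End metric_measure.

(* Main.v *)
Require Import Defs.
From mathcomp Require Import all_boot all_order all_algebra.
From mathcomp Require Import all_classical all_reals all_analysis.
From mathcomp Require Import measurable_realfun.
From mathcomp Require finmap.
From mathcomp Require Import ring lra.
Import Order.TTheory GRing.Theory Num.Theory.
Import numFieldNormedType.Exports.
Local Open Scope classical_set_scope.
Local Open Scope ring_scope.

(* Call a ball mixed when both E and its complement fill a fixed proportion of
   it, and give it the weight mu(B) / r. The Poincare inequality bounds the total
   weight of separated mixed balls by the perimeter of E. Conversely, applying it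
   to a Lipschitz function whose gradient lives on mixed balls of a small radius s
   shows that a mixed ball contains separated mixed balls of radius comparable to
   s, of at least comparable total weight. Let F_m be the set of points around
   which no ball of radius < 1/(m+1) is mixed (for a smaller proportion). If thin
   neighbourhoods of F_m carried mixed packings of weight bounded below at all
   scales, refining them would produce such packings in infinitely many disjoint
   annuli around F_m, whose weights would add up beyond the perimeter bound. Hence
   F_m has a neighbourhood N_m whose mixed packings at small scales have
   arbitrarily small weight, and a Vitali covering turns them into a test function
   rho_m of arbitrarily small integral. A curve that avoids the measure-theoretic
   boundary is covered by finitely many N_m; if it also passes from the interior
   to the exterior of E, it meets a mixed ball at every small scale, so that
   sum rho_m has integral at least 1 along it. *)

Set Implicit Arguments.
Unset Strict Implicit.
Unset Printing Implicit Defensive.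

(** * Doubling measures *)

Section metric_balls.
Context {R : realType} {X : completeMetricType R}.

Lemma ballP (x y : X) (r : R) : ball x r y <-> mdist x y < r.
Proof. by rewrite ballEmdist. Qed.

Lemma ball_subset (x y : X) (r s : R) :
  mdist x y + r <= s -> ball y r `<=` ball x s.
Proof.
move=> h z /ballP yz; apply/ballP.
by have := metric_triangle x y z; lra.
Qed.

Lemma open_metric_ball (x : X) (r : R) :
  open (ball x r).
Proof.
rewrite openE => z /ballP xz.
apply/nbhs_ballP; exists (r - mdist x z) => /=; first by rewrite subr_gt0.
by apply: ball_subset; rewrite addrC subrK.
Qed.

Lemma ball_disjoint (x y : X) (r s : R) :
  r + s <= mdist x y -> ball x r `&` ball y s = set0.
Proof.
move=> h; apply/seteqP; split => // z [/ballP xz /ballP yz].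
have := metric_triangle x z y; rewrite (metric_sym z y) => ?.
by exfalso; lra.
Qed.

Definition separated (s : R) (l : seq X) :=
  forall z z', z \in l -> z' \in l -> z != z' -> s <= mdist z z'.

End metric_balls.

Section outer.
Context {R : realType} {X : completeMetricType R}.
Context (mu : {outer_measure set X -> \bar R}).

(** Caratheodory's criterion for the first set is tested on [Y], and the remaining sets lie in its
    complement; [Y] itself may be non-measurable. *)
Lemma sum_disjoint_le (T : eqType) (l : seq T) (F : T -> set X) (Y : set X) :
  uniq l -> (forall t, t \in l -> mu.-caratheodory (F t)) ->
  (forall t t', t \in l -> t' \in l -> t != t' -> F t `&` F t' = set0) ->
  (\sum_(t <- l) mu (Y `&` F t) <= mu Y)%E.
Proof.
elim: l Y => [|a l IH] Y /=; first by rewrite big_nil outer_measure_ge0.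
move=> /andP[al ul] cF dF; rewrite big_cons.
rewrite (cF a (mem_head _ _) Y) leeD2l//.
apply: le_trans (IH (Y `&` ~` F a) ul _ _); last 2 first.
- by move=> t tl; apply: cF; rewrite inE tl orbT.
- by move=> t t' tl t'l; apply: dF; rewrite inE ?tl ?t'l orbT.
rewrite le_eqVlt; apply/orP; left; apply/eqP; apply: eq_big_seq => t tl.
congr (mu _); rewrite -setIA; congr (_ `&` _).
apply/seteqP; split => [z Fz|z []//]; split => // Faz.
have : (F t `&` F a) z by [].
by rewrite dF ?inE ?tl ?eqxx ?orbT//; apply: contraNneq al => <-.
Qed.

Lemma outer_measure_seq_le (T : eqType) (l : seq T) (F : T -> set X) (Y : set X) :
  (forall y, Y y -> exists2 t, t \in l & F t y) ->
  (mu Y <= \sum_(t <- l) mu (F t))%E.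
Proof.
elim: l Y => [|a l IH] Y h.
  rewrite big_nil; suff -> : Y = set0 by rewrite outer_measure0.
  by apply/seteqP; split => // y /h[].
rewrite big_cons; apply: (@le_trans _ _ (mu (F a) + mu (Y `\` F a))%E).
  apply: le_trans (outer_measureU2 mu _ _).
  by apply: le_outer_measure => y Yy; case: (pselect (F a y)); [left|right].
apply: leeD2l; apply: IH => y [/h[t]]; rewrite inE => /orP[/eqP ->//|tl Ft _].
by exists t.
Qed.

End outer.

Section doubling.
Context {R : realType} {X : completeMetricType R}.
Context (mu : {outer_measure set X -> \bar R}).
Context (mu_regular : borel_regular mu) (mu_doubling : doubling mu).

(* [vol A] is meaningful only when [mu A] is finite, e.g. for bounded [A];
   otherwise it is 0. *)
Definition vol (A : set X) : R := fine (mu A).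

Lemma ball_caratheodory (x : X) (r : R) : mu.-caratheodory (ball x r).
Proof.
by apply: mu_regular.1; apply: sub_sigma_algebra; exact: open_metric_ball.
Qed.

Lemma mu_ball_gt0 (x : X) (r : R) : 0 < r -> (0 < mu (ball x r))%E.
Proof.
move=> r0; have [C _ /(_ x (r / 2)) []] := mu_doubling.
  by rewrite divr_gt0.
by rewrite mulrCA divff ?mulr1.
Qed.

Lemma mu_ball_lty (x : X) (r : R) : (mu (ball x r) < +oo)%E.
Proof.
have [r0|r0] := ltP 0 r; last first.
  suff -> : ball x r = set0 by rewrite outer_measure0.
  by apply/seteqP; split => // y /ballP; have := mdist_ge0 x y; lra.
have [C C1 /(_ x r r0) [_ _]] := mu_doubling.
apply: le_lt_trans; rewrite -[leLHS]mul1e.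
by rewrite lee_pmul// ?lee_fin// outer_measure_ge0.
Qed.

Lemma vol_ge0 A : 0 <= vol A.
Proof. by rewrite fine_ge0// outer_measure_ge0. Qed.

Lemma mu_bounded_lty (A : set X) x r : A `<=` ball x r -> (mu A < +oo)%E.
Proof.
by move=> /(le_outer_measure mu)/le_lt_trans; apply; exact: mu_ball_lty.
Qed.

Lemma vol_EFin (A : set X) x r : A `<=` ball x r -> (mu A = (vol A)%:E).
Proof.
by move=> /mu_bounded_lty Af; rewrite /vol fineK// ge0_fin_numE//.
Qed.

Lemma vol_ballE x r : mu (ball x r) = (vol (ball x r))%:E.
Proof. exact: (@vol_EFin _ x r). Qed.

Lemma le_vol (A B : set X) x r : A `<=` B -> B `<=` ball x r -> vol A <= vol B.
Proof.
move=> AB Br; rewrite -lee_fin -(vol_EFin Br) -(vol_EFin (subset_trans AB Br)).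
exact: le_outer_measure.
Qed.

Lemma vol_ball_gt0 x r : 0 < r -> 0 < vol (ball x r).
Proof. by move=> r0; rewrite -lte_fin -vol_ballE; exact: mu_ball_gt0. Qed.

Lemma vol_ball_le (x y : X) (r s : R) :
  mdist x y + r <= s -> vol (ball y r) <= vol (ball x s).
Proof. by move=> /ball_subset h; exact: (le_vol h (@subset_refl _ _)). Qed.

Lemma vol_ball_scale (tau : R) : exists2 K : R, 1 <= K &
  forall (x : X) (r : R), 0 < r -> vol (ball x (tau * r)) <= K * vol (ball x r).
Proof.
have [C C1 HC] := mu_doubling.
have Hn n : forall x r, 0 < r ->
    vol (ball x (2 ^+ n * r)) <= C ^+ n * vol (ball x r).
  elim: n => [|n IH] x r r0; first by rewrite !mul1r.
  have r20 : 0 < 2 ^+ n * r by rewrite mulr_gt0// exprn_gt0.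
  have [_ + _] := HC x _ r20.
  rewrite !vol_ballE -EFinM lee_fin !exprS -!mulrA => /le_trans; apply.
  by rewrite ler_wpM2l ?IH//; lra.
have /archi_boundP : 0 <= `|tau| by [].
set n := Num.bound _ => hn.
exists (C ^+ n); first exact: exprn_ege1.
move=> x r r0; apply: le_trans (Hn n x r r0); apply: vol_ball_le.
rewrite mdistxx add0r ler_wpM2r ?(ltW r0)//.
rewrite (le_trans (ler_norm _))// (le_trans (ltW hn))//.
by rewrite -natrX ler_nat ltnW// ltn_expl.
Qed.

(** The balls of radius [s / 2] around the points are disjoint and lie in one ball [Y] of radius
    comparable to [s]; by doubling each has measure at least [vol Y / K], so there are at most [K]
    of them. *)
Lemma separated_size (tau : R) : exists N : nat, forall (y : X) (s : R) (l : seq X), 0 < s ->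
  uniq l -> (forall z, z \in l -> mdist y z < tau * s) -> separated s l ->
  (size l <= N)%N.
Proof.
have [K K1 HK] := vol_ball_scale (4 * `|tau| + 2).
have K0 : 0 < K by lra.
have /archi_boundP : 0 <= K by lra.
set N := Num.bound _ => hN; exists N => y s l s0 ul ly sl.
have tau0 : 0 <= `|tau| by [].
have ttau : tau * s <= `|tau| * s by rewrite ler_wpM2r ?ler_norm ?ltW.
set Y := ball y ((`|tau| + 1) * s).
have tau1 : 0 < `|tau| + 1 by lra.
have Y0 : 0 < vol Y by apply: vol_ball_gt0; rewrite mulr_gt0.
have subY z : z \in l -> ball z (s / 2) `<=` Y.
  move=> /ly yz; apply: ball_subset.
  by rewrite [leRHS]mulrDl mul1r; lra.
have h : (\sum_(z <- l) mu (Y `&` ball z (s / 2)) <= mu Y)%E.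
  apply: sum_disjoint_le => //.
    by move=> t _; exact: ball_caratheodory.
  move=> t t' tl t'l tt'; apply: ball_disjoint; rewrite -splitr.
  exact: sl.
have h2 : (\sum_(z <- l) (vol Y / K)%:E <= mu Y)%E.
  apply: le_trans h; rewrite big_seq [leRHS]big_seq; apply: lee_sum => z zl.
  have -> : Y `&` ball z (s / 2) = ball z (s / 2) by exact/setIidr/subY.
  rewrite vol_ballE lee_fin ler_pdivrMr// mulrC.
  have /(HK z) : 0 < s / 2 by lra.
  apply: le_trans; apply: vol_ball_le; rewrite metric_sym.
  have -> : (4 * `|tau| + 2) * (s / 2) = (`|tau| * s) + (`|tau| + 1) * s.
    by field.
  by rewrite lerD2r; have := ly _ zl; lra.
have h3 : vol Y / K *+ size l <= vol Y.
  rewrite -lee_fin; move: h2; rewrite sumEFin vol_ballE.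
  by rewrite big_const_seq count_predT iter_addr_0.
rewrite -ltnS -(ltr_nat R); apply: le_lt_trans (_ : K < _); last first.
  by apply: lt_le_trans hN _; rewrite ler_nat.
rewrite -mulr_natr mulrAC ler_pdivrMr// in h3.
by rewrite -(ler_pM2l Y0).
Qed.

(** By [separated_size] some separated list in [S] has maximal length; a point of [S] at distance at
    least [s] from all its entries could be added to it. *)
Lemma maximal_net (S : set X) (y : X) (rho s : R) : 0 < s ->
  S `<=` ball y rho -> exists l : seq X,
  [/\ uniq l, forall z, z \in l -> S z, separated s l &
      forall x, S x -> exists2 z, z \in l & mdist z x < s].
Proof.
move=> s0 Sy; have [N HN] := separated_size (rho / s).
pose P n := `[< exists l : seq X, [/\ uniq l, forall z, z \in l -> S z,
  separated s l & size l = n] >].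
have exP : exists n, P n by exists 0%N; apply/asboolP; exists [::].
have ubP n : P n -> (n <= N)%N.
  move=> /asboolP[l [ul lS sl <-]]; apply: (HN y s) => //.
  by move=> z /lS/Sy/ballP; rewrite divfK// gt_eqF.
case: (ex_maxnP exP ubP) => n /asboolP[l [ul lS sl sn]] maxn.
exists l; split => // x Sx; apply: contrapT => hx.
have xz z : z \in l -> s <= mdist z x.
  by move=> zl; rewrite leNgt; apply/negP => h; apply: hx; exists z.
have xl : x \notin l.
  by apply/negP => /xz; rewrite mdistxx; lra.
suff /maxn : P n.+1 by rewrite ltnn.
apply/asboolP; exists (x :: l); split => /=; [by rewrite xl| | |by rewrite sn].
- by move=> z; rewrite inE => /orP[/eqP ->//|/lS].
- move=> z z'; rewrite !inE => /orP[/eqP ->|zl] /orP[/eqP ->|z'l].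
  + by rewrite eqxx.
  + by move=> _; rewrite metric_sym xz.
  + by move=> _; exact: xz.
  + exact: sl.
Qed.

End doubling.

(** * From local conditions to all balls *)

Section local_to_global.
Context {R : realType} {X : completeMetricType R}.
Context (mu : {outer_measure set X -> \bar R}).
Context (mu_regular : borel_regular mu) (mu_doubling : doubling mu).

(* Otherwise the complements of good sets generate a proper filter containing a
   ball; by total boundedness an ultrafilter refining it is Cauchy, and its limit
   has no good neighbourhood. *)
Lemma local_ball_ind (P : set X -> Prop) :
  (forall A B, A `<=` B -> P B -> P A) ->
  (forall A B, P A -> P B -> P (A `|` B)) ->
  (forall x, exists2 r, 0 < r & P (ball x r)) ->
  forall x r, P (ball x r).
Proof.
move=> PS PU Ploc x0 r0; apply: contrapT => nP.
have P0 : P set0 by have [r _] := Ploc x0; apply: PS.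
pose F : set_system X := [set A | P (ball x0 r0 `&` ~` A)].
have FF : ProperFilter F.
  split; first by rewrite /F/= setC0 setIT.
  split; rewrite /F/=.
  - by rewrite setCT setI0.
  - by move=> A B PA PB; apply: PS (PU _ _ PA PB) => z [z1 /not_andP[]]; [left|right].
  - move=> A B AB; apply: PS => z [z1 z2]; split => // /AB//.
have [G [GU FG]] := ultraFilterLemma FF.
have : cauchy G.
  apply: cauchy_exP => e e0.
  have [l [_ _ _ hl]] :=
    maximal_net mu_regular mu_doubling e0 (@subset_refl _ (ball x0 r0)).
  (* If no ball of radius [e] belonged to [G], the complement of the finite net of balls would,
     although that net covers [ball x0 r0], which is in [G]. *)
  apply: contrapT => nG.
  have Gl (l' : seq X) : G [set y | forall z, z \in l' -> ~ ball z e y].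
    elim: l' => [|z l' IH]; first by apply: filterS (filterT) => y.
    have [Gz|Gz] := in_ultra_setVsetC (ball z e) GU.
      by exfalso; apply: nG; exists z.
    apply: filterS (filterI IH Gz) => y [/= h hz] z'.
    by rewrite inE => /orP[/eqP ->//|]; exact: h.
  have Gx : G (ball x0 r0) by apply: FG; rewrite /F/= setICr.
  have [y [/= h /hl[z zl /ballP zy]]] := filter_ex (@filterI _ G _ _ _ (Gl l) Gx).
  exact: h zl zy.
move=> /(cauchy_cvg _) Gc.
have /cvg_ex[z Gz] := Gc.
have [r rp Pr] := Ploc z.
have Gb : G (ball z r) by apply: Gz; exact: nbhsx_ballx.
have Gb' : G (~` ball z r).
  by apply: FG; rewrite /F/= setCK; apply: PS Pr => y [].
by have [y []] := filter_ex (@filterI _ G _ _ _ Gb Gb').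
Qed.

Lemma cara_measurable_ball (x : X) (r : R) :
  measurable (ball x r : set (caratheodory_type mu)).
Proof. exact: (ball_caratheodory mu_regular). Qed.

Lemma cvg_L1loc_ball (u_ : nat -> X -> \bar R) (u : X -> \bar R) :
  (forall i, measurable_fun [set: caratheodory_type mu]
     (fun y : caratheodory_type mu => `|u_ i y - u y|)%E) ->
  cvg_L1loc mu u_ u -> forall x r,
  (fun i => \int[cara_measure mu]_(y in ball x r) `|u_ i y - u y|)%E @ \oo --> 0%E.
Proof.
move=> mf cu x r.
(* The measurable superset [B] makes the predicate pass to arbitrary subsets, as [local_ball_ind]
   requires. *)
pose P (A : set X) := exists B : set (caratheodory_type mu),
  [/\ measurable B, A `<=` B &
   (fun i => \int[cara_measure mu]_(y in B) `|u_ i y - u y|)%E @ \oo --> 0%E].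
have mfB i B : measurable_fun B (fun y : caratheodory_type mu => `|u_ i y - u y|)%E.
  exact: measurable_funTS.
have : P (ball x r).
  apply: local_ball_ind.
  - by move=> A B AB [C [mC BC hC]]; exists C; split => //; exact: subset_trans BC.
  - move=> A B [C [mC AC hC]] [D [mD BD hD]]; exists (C `|` D); split.
    + exact: measurableU.
    + exact: setUSS.
    + apply: (@squeeze_cvge _ _ _ _ (cst 0%E) _
        (fun i => \int[cara_measure mu]_(y in C) `|u_ i y - u y| +
                  \int[cara_measure mu]_(y in D) `|u_ i y - u y|)%E); last 2 first.
      * exact: cvg_cst.
      * by rewrite -[X in _ --> X]add0e; apply: cvgeD.
      near=> i; apply/andP; split; first exact: integral_ge0.
      rewrite -(setDUK (@subsetUl _ C D)) ge0_integral_setU//; last 2 first.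
      * by apply: measurableD => //; exact: measurableU.
      * by rewrite disj_set2E setDIK.
      apply: leeD2l; apply: ge0_subset_integral => //.
      * by apply: measurableD => //; exact: measurableU.
      * by move=> z [[//|//]].
  - move=> z; have [s s0 hs] := cu z; exists s => //; exists (ball z s); split => //.
    exact: cara_measurable_ball.
move=> [B [mB AB hB]].
apply: (@squeeze_cvge _ _ _ _ (cst 0%E) _
    (fun i => \int[cara_measure mu]_(y in B) `|u_ i y - u y|)%E) => //; last first.
  exact: cvg_cst.
near=> i; apply/andP; split; first exact: integral_ge0.
apply: ge0_subset_integral => //; exact: cara_measurable_ball.
Unshelve. all: by end_near.
Qed.

End local_to_global.

(** * Consequences of the Poincare inequality *)

Section measurability.
Context {R : realType} {X : completeMetricType R}.
Context (mu : {outer_measure set X -> \bar R}).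
Context (mu_regular : borel_regular mu).

Lemma borel_fun_cara (f : X -> \bar R) : borel_fun f ->
  measurable_fun [set: caratheodory_type mu] (f : caratheodory_type mu -> \bar R).
Proof.
move=> bf _ Y mY; rewrite setTI; apply: mu_regular.1.
by have := bf measurableT Y mY; rewrite setTI.
Qed.

Lemma continuous_borel_fun (u : X -> R) : continuous u -> borel_fun (EFin \o u).
Proof.
move=> /continuousP cu; apply/measurable_EFinP.
move=> mT; apply: (measurability _ (RGenOpens.measurableE R)) => //.
move=> _ [_ [a [b ->] <-]]; rewrite setTI.
by apply: sub_sigma_algebra; apply: cu; exact: interval_open.
Qed.

Lemma loc_lipschitz_continuous (u : X -> R) : loc_lipschitz u -> continuous u.
Proof.
move=> lu x; have [r r0 [L hL]] := lu x.
apply/cvgrPdist_lt => e e0.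
have L0 : 0 < `|L| + 1 by have := normr_ge0 L; lra.
apply/nbhs_ballP; exists (Num.min r (e / (`|L| + 1))) => /=.
  by rewrite lt_min r0 divr_gt0.
move=> y /ballP; rewrite lt_min => /andP[/ballP xy xye].
apply: le_lt_trans (hL x y (ballxx x r0) xy) _.
apply: le_lt_trans (_ : (`|L| + 1) * mdist x y < e); last first.
  by rewrite mulrC -ltr_pdivlMr.
rewrite ler_wpM2r ?mdist_ge0// (le_trans (ler_norm _))//; lra.
Qed.

End measurability.

Section energy.
Context {R : realType} {X : completeMetricType R}.
Context (mu : {outer_measure set X -> \bar R}).
Context (mu_regular : borel_regular mu) (mu_doubling : doubling mu).
Context (mu_poincare : poincare mu).
Local Open Scope ereal_scope.

Lemma loc_lipschitz_L1loc (u : X -> R) : loc_lipschitz u -> L1loc mu (EFin \o u).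
Proof.
move=> lu; have cu := loc_lipschitz_continuous lu.
have mu_ := borel_fun_cara mu_regular (continuous_borel_fun cu).
split => // x; have [r r0 [L hL]] := lu x; exists r => //.
have L0 : (0 <= `|u x| + `|L| * r)%R.
  by rewrite addr_ge0// mulr_ge0// ltW.
apply: le_lt_trans (_ : \int[cara_measure mu]_(y in ball x r)
    (cst (`|u x| + `|L| * r)%:E y) < +oo).
  apply: ge0_le_integral => //.
  - exact: cara_measurable_ball.
  - by apply: measurable_funTS; apply: measurableT_comp.
  - move=> y xy /=; rewrite lee_fin.
    have -> : u y = (u x + (u y - u x))%R by rewrite addrC subrK.
    apply: le_trans (ler_normD _ _) _; rewrite lerD2l.
    apply: le_trans (hL y x xy (ballxx x r0)) _.
    apply: le_trans (_ : `|L| * mdist y x <= _)%R.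
      by rewrite ler_wpM2r ?mdist_ge0// ler_norm.
    by rewrite ler_wpM2l// ltW// metric_sym; apply/ballP.
rewrite integral_cst; last exact: cara_measurable_ball.
by rewrite lte_mul_pinfty ?lee_fin//; exact: mu_ball_lty.
Qed.

(** The Poincare inequality with the measures of the two balls cleared. Of the average only the
    existence of some constant [a] is kept, which is all that [oscillation_ge] needs. *)
Definition ball_poincare (C lambda : R) :=
  forall (x : X) (r : R) (u g : X -> \bar R), (0 < r)%R ->
    L1loc mu u -> upper_gradient u g ->
    exists a : \bar R,
    \int[cara_measure mu]_(y in ball x r) `|u y - a| <=
    (C * r)%:E * \int[cara_measure mu]_(y in ball x (lambda * r)) g y.

Lemma poincare_ball : exists C lambda : R,
  [/\ (0 < C)%R, (1 <= lambda)%R & ball_poincare C lambda].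
Proof.
have [C [lambda [C0 l1 h]]] := mu_poincare; exists C, lambda; split => //.
move=> x r u g r0 Lu ug; exists (average mu (ball x r) u).
have := h x r u g r0 Lu ug; rewrite {1 3}/average.
set I1 := (\int[_]_(y in _) _); set I2 := (\int[_]_(y in _) _).
have lr0 : (0 < lambda * r)%R by rewrite mulr_gt0//; lra.
have v1 := vol_ball_gt0 mu_doubling x r0.
have v2 := vol_ball_gt0 mu_doubling x lr0.
rewrite !(vol_ballE mu_doubling) !inver !gt_eqF//.
have I20 : 0 <= I2 by apply: integral_ge0 => y _; case: ug.
rewrite lee_pdivrMl// => /le_trans; apply.
rewrite muleCA; apply: lee_wpmul2l; first by rewrite lee_fin mulr_ge0 ?ltW.
rewrite muleA -EFinM -[leRHS]mul1e; apply: lee_wpmul2r => //; rewrite lee_fin.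
rewrite ler_pdivrMr// mul1r; apply: (vol_ball_le mu_doubling).
by rewrite mdistxx add0r ler_peMl// ltW.
Qed.

(** Every [a] is at total distance at least 1 from the values 1 and 0, so the integral dominates a
    combination of the two volumes whose weights [b1], [b0] add up to at least 1. For infinite [a]
    both distances are infinite and the weights 1, 0 will do. *)
Lemma oscillation_ge (F1 F0 : set X) (f : X -> \bar R) (a : \bar R) x r :
  mu.-caratheodory F1 -> mu.-caratheodory F0 ->
  measurable_fun [set: caratheodory_type mu] (f : caratheodory_type mu -> \bar R) ->
  (forall y, F1 y -> f y = 1) -> (forall y, F0 y -> f y = 0) ->
  (Num.min (vol mu (ball x r `&` F1)) (vol mu (ball x r `&` F0)))%:E <=
  \int[cara_measure mu]_(y in ball x r) `|f y - a|.
Proof.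
move=> mF1 mF0 mf f1 f0.
have [b1 [b0 [b10 b00 b b1a b0a]]] : exists b1 b0 : R,
    [/\ (0 <= b1)%R, (0 <= b0)%R, (1 <= b1 + b0)%R, b1%:E <= `|1 - a| & b0%:E <= `|0 - a|].
  case: a => [a| |].
  - exists (`|1 - a|)%R, (`|a|)%R; split => //.
    + by have := ler_norm a; have := ler_norm (1 - a)%R; lra.
    + by rewrite /= sub0r normrN.
  - by exists 1%R, 0%R; split; rewrite ?addr0 ?leey.
  - by exists 1%R, 0%R; split; rewrite ?addr0 ?leey.
have mB := cara_measurable_ball mu_regular x r.
have m1 : measurable (F1 : set (caratheodory_type mu)) by [].
have m0 : measurable (F0 : set (caratheodory_type mu)) by [].
have mind (F : set (caratheodory_type mu)) : measurable F ->
    measurable_fun (ball x r : set (caratheodory_type mu)) (fun y => (\1_F y : R)%:E).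
  by move=> mF; apply/measurable_EFinP; apply: measurable_funTS; exact: measurable_indic.
apply: (@le_trans _ _ (\int[cara_measure mu]_(y in ball x r)
   (b1%:E * (\1_F1 y)%:E + b0%:E * (\1_F0 y)%:E))); last first.
  apply: ge0_le_integral => //.
  - by move=> y _; rewrite adde_ge0// mule_ge0// lee_fin.
  - by apply: emeasurable_funD; apply: measurable_funeM; exact: mind.
  - by apply: measurable_funTS; apply: measurableT_comp => //; apply: emeasurable_funB.
  - move=> y _; rewrite !indicE; have [F1y|F1y] := boolP (y \in F1).
      have [F0y|F0y] := boolP (y \in F0).
        move: F1y F0y; rewrite !inE => /f1 f1y /f0; rewrite f1y => /eqP.
        by rewrite onee_eq0.
      by rewrite mule1 mule0 adde0 f1//; exact/set_mem.
    have [F0y|F0y] := boolP (y \in F0); last by rewrite !mule0 adde0.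
    by rewrite mule1 mule0 add0e f0//; exact/set_mem.
rewrite ge0_integralD//; last 4 first.
- by move=> y _; rewrite mule_ge0// lee_fin.
- by apply: measurable_funeM; exact: mind.
- by move=> y _; rewrite mule_ge0// lee_fin.
- by apply: measurable_funeM; exact: mind.
rewrite !ge0_integralZl_EFin//; try exact: mind.
rewrite !integral_indic//=.
rewrite ![_ `&` ball x r]setIC.
have subB F : ball x r `&` F `<=` ball x r by exact: subIsetl.
rewrite (vol_EFin mu_doubling (subB F1)) (vol_EFin mu_doubling (subB F0)).
rewrite -!EFinM -EFinD lee_fin.
set v1 := vol _ _; set v0 := vol _ _.
have v10 : (0 <= v1)%R by exact: vol_ge0.
have v00 : (0 <= v0)%R by exact: vol_ge0.
case: (leP v1 v0) => v01; nra.
Qed.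

End energy.

Lemma limn_einf_frequently {R : realType} (v : nat -> \bar R) :
  (limn_einf v < +oo)%E ->
  exists M : R, 0 <= M /\ forall n, exists2 i, (n <= i)%N & (v i <= M%:E)%E.
Proof.
move=> vy; have [M [M0 vM]] : exists M : R, 0 <= M /\ (limn_einf v < M%:E)%E.
  case: (limn_einf v) vy => [a| |] // _.
    exists (`|a| + 1); rewrite lte_fin; split => //.
    by have := ler_norm a; lra.
  by exists 0; rewrite ltNyr.
exists M; split => // n; apply: contrapT => h.
move: vM; rewrite ltNge => /negP; apply.
rewrite /limn_einf /limn_esup /limf_esup leeNr.
apply: (@le_trans _ _ (ereal_sup ((\- v)%E @` [set i | (n <= i)%N]))).
  by apply: ereal_inf_lbound; exists [set i | (n <= i)%N] => //; exists n.
apply: ge_ereal_sup => _ [i /= ni <-]; rewrite /= EFinN leeN2 leNgt.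
by apply/negP => /ltW vi; apply: h; exists i.
Qed.

Lemma sum_restrict_le {R : realType} (I X : Type) (P : seq I) (D : I -> set X)
    (g : X -> \bar R) (N : nat) (z : X) : (0 <= g z)%E ->
  (count (fun p => z \in D p) P <= N)%N ->
  (\sum_(p <- P) (g \_ (D p)) z <= N%:R%:E * g z)%E.
Proof.
move=> g0 cN; apply: (@le_trans _ _ ((count (fun p => z \in D p) P)%:R%:E * g z)%E).
  elim: P {cN} => [|p P IH]; first by rewrite big_nil mul0e.
  rewrite big_cons /= natrD EFinD ge0_muleDl ?lee_fin//.
  apply: leeD => //; rewrite patchE; case: ifP => _; first by rewrite mul1e.
  by rewrite mul0e.
by apply: lee_wpmul2r => //; rewrite lee_fin ler_nat.
Qed.

(** * The perimeter bounds the mixture of balls with bounded overlap *)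

Section energy_bound.
Context {R : realType} {X : completeMetricType R}.
Context (mu : {outer_measure set X -> \bar R}).
Context (mu_regular : borel_regular mu) (mu_doubling : doubling mu).
Local Open Scope ereal_scope.

Lemma sum_integral_le (I : Type) (P : seq I) (D : I -> set X)
    (g : X -> \bar R) (N : nat) :
  (forall p, measurable (D p : set (caratheodory_type mu))) ->
  measurable_fun [set: caratheodory_type mu] (g : caratheodory_type mu -> \bar R) ->
  (forall z, 0 <= g z) ->
  (forall z, (count (fun p => z \in D p) P <= N)%N) ->
  \sum_(p <- P) \int[cara_measure mu]_(y in D p) g y <=
  N%:R%:E * \int[cara_measure mu]_y g y.
Proof.
move=> mD mg g0 cN.
under eq_bigr do rewrite integral_mkcond.
rewrite -ge0_integral_sum//; last 2 first.
- by move=> p; apply/(measurable_restrictT _ (mD p)); exact: measurable_funTS.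
- by move=> p z _; exact: erestrict_ge0.
rewrite -ge0_integralZl_EFin//.
apply: ge0_le_integral => //.
- by move=> z _; apply: sume_ge0 => p _; exact: erestrict_ge0.
- apply: emeasurable_sum => p; apply/(measurable_restrictT _ (mD p)).
  exact: measurable_funTS.
- by apply: measurable_funeM.
- by move=> z _; exact: sum_restrict_le.
Qed.

Context (E : set X).

(** By [oscillation_ge], a lower bound for the L1 distance on the ball from the indicator of [E] to
    any constant. *)
Definition mixture (x : X) (r : R) : R :=
  Num.min (vol mu (ball x r `&` E)) (vol mu (ball x r `&` ~` E)).

Context (E_perimeter : finite_perimeter mu E).

(** The Poincare inequality is applied on each ball to one locally Lipschitz [u i], far along a
    sequence of finite energy converging to the indicator of [E]. The gradient integrals add up to
    at most [N] times the energy, since the dilated balls overlap at most [N] times. *)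
Lemma mixture_sum_bound (C lambda : R) : (0 < C)%R -> (1 <= lambda)%R ->
  ball_poincare mu C lambda ->
  exists2 M : R, (0 <= M)%R & forall (N : nat) (P : seq (X * R)),
    (forall p, p \in P -> 0 < p.2)%R ->
    (forall z : X, (count (fun p : X * R => z \in (ball p.1 (lambda * p.2) : set X)) P <= N)%N) ->
    (\sum_(p <- P) mixture p.1 p.2 / p.2 <= N%:R * M)%R.
Proof.
move=> C0 l1 HP.
have [mE] := E_perimeter.
rewrite /total_variation => /ereal_inf_lt[_ [[u g] /= [lu ug cu] <-]].
move=> /limn_einf_frequently[M [M0 hM]].
exists (C * M)%R; first by rewrite mulr_ge0// ltW.
move=> N P P0 cN; apply/ler_addgt0Pr => e e0.
have mu_ i := borel_fun_cara mu_regular (continuous_borel_fun (loc_lipschitz_continuous (lu i))).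
have m1 : measurable_fun [set: caratheodory_type mu]
    (EFin \o (\1_E : X -> R) : caratheodory_type mu -> \bar R).
  by apply/measurable_EFinP; exact: measurable_indic.
have mdiff i : measurable_fun [set: caratheodory_type mu]
    (fun y : caratheodory_type mu => `|(EFin \o u i) y - (EFin \o \1_E) y|).
  by apply: measurableT_comp => //; apply: emeasurable_funB => //; exact: mu_.
have cB := cvg_L1loc_ball mu_regular mu_doubling mdiff cu.
(* The error [e] is shared among the balls of [P]; the successor keeps the denominator positive when
   [P] is empty. *)
pose d := (e / (size P).+1%:R)%R.
have d0 : (0 < d)%R by rewrite divr_gt0.
(* One index serves all the balls, because [P] is finite. *)
have [n hn] : exists n, forall i, (n <= i)%N -> forall p, p \in P ->
    \int[cara_measure mu]_(y in ball p.1 p.2) `|(u i y)%:E - (\1_E y)%:E| <=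
    (d * p.2)%:E.
  elim: P P0 {cN} d d0 => [|p P IH] P0 d d0; first by exists 0%N.
  have [|n hn] := IH _ d d0; first by move=> q qP; apply: P0; rewrite inE qP orbT.
  have p0 : (0 < d * p.2)%R by rewrite mulr_gt0// P0// mem_head.
  have /(cB p.1 p.2) [m _ hm] : nbhs 0 [set y : \bar R | y < (d * p.2)%:E].
    by apply: open_nbhs_nbhs; split; [exact: open_ereal_lt_ereal|rewrite /= lte_fin].
  exists (maxn n m) => i; rewrite geq_max => /andP[ni mi] q.
  rewrite inE => /predU1P[->|qP]; last exact: hn.
  exact: ltW (hm i mi).
have [i ni gM] := hM n.
have ug0 z : 0 <= g i z by case: (ug i).
have mg : measurable_fun [set: caratheodory_type mu] (g i : caratheodory_type mu -> \bar R).
  by apply: borel_fun_cara => //; case: (ug i).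
have key p : p \in P -> (mixture p.1 p.2 / p.2)%:E <=
    d%:E + C%:E * \int[cara_measure mu]_(y in ball p.1 (lambda * p.2)) g i y.
  move=> pP; have p0 := P0 p pP.
  have [a ha] := HP p.1 p.2 _ _ p0
    (loc_lipschitz_L1loc mu_regular mu_doubling (lu i)) (ug i).
  have mB := cara_measurable_ball mu_regular p.1 p.2.
  have mua : measurable_fun [set: caratheodory_type mu]
      (fun y : caratheodory_type mu => `|(u i y)%:E - a|).
    by apply: measurableT_comp => //; apply: emeasurable_funB => //; exact: mu_.
  have G0 : 0 <= C%:E * \int[cara_measure mu]_(y in ball p.1 (lambda * p.2)) g i y.
    by apply: mule_ge0; [rewrite lee_fin ltW|exact: integral_ge0].
  have d0' : 0 <= d%:E by rewrite lee_fin ltW.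
  rewrite mulrC EFinM lee_pdivrMl// ge0_muleDr//.
  rewrite muleA -!EFinM mulrC [in X in _ + X]mulrC.
  apply: le_trans (leeD (hn i ni p pP) ha).
  rewrite -ge0_integralD//; last 2 first.
  - exact: measurable_funTS (mdiff i).
  - exact: measurable_funTS.
  apply: (@le_trans _ _ (\int[cara_measure mu]_(y in ball p.1 p.2) `|(\1_E y)%:E - a|)).
    apply: (oscillation_ge mu_regular mu_doubling) => //.
    - exact: caratheodory_measurable_setC.
    - by move=> y Ey; rewrite indicE mem_set.
    - by move=> y Ey; rewrite indicE memNset.
  apply: ge0_le_integral => //.
  - by apply: measurable_funTS; apply: measurableT_comp => //; exact: emeasurable_funB.
  - apply: measurable_funTS; apply: emeasurable_funD => //; exact: mdiff.
  - move=> y _; case: a {ha mua} => [a| |] /=; rewrite ?leey//.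
    rewrite -EFinD lee_fin -(distrC (\1_E y)).
    by have := ler_distD (u i y) (\1_E y) a.
rewrite -lee_fin -sumEFin big_seq.
apply: le_trans (lee_sum _ key) _; rewrite -big_seq big_split /=.
rewrite -ge0_sume_distrr; last by move=> p _; exact: integral_ge0.
rewrite addeC EFinD; apply: leeD.
  rewrite mulrCA EFinM; apply: lee_wpmul2l; first by rewrite lee_fin ltW.
  apply: le_trans (sum_integral_le _ mg _ cN) _ => //.
    by move=> p; exact: cara_measurable_ball.
  by rewrite EFinM; apply: lee_wpmul2l; rewrite ?lee_fin.
rewrite sumEFin lee_fin big_const_seq count_predT iter_addr_0.
rewrite -[(d *+ _)%R]mulr_natr /d mulrAC ler_pdivrMr// ler_wpM2l ?ltW//.
by rewrite ltr_nat.
Qed.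

End energy_bound.

(** * Curves and upper gradients *)

(* No measurability is needed: the integral of a nonnegative function is a
   supremum over the simple functions below it. *)
Lemma ge0_integral_le d (T : measurableType d) (R : realType)
    (m : {measure set T -> \bar R}) (D : set T) (f g : T -> \bar R) :
  (forall x, D x -> (0 <= f x)%E) -> (forall x, D x -> (f x <= g x)%E) ->
  (\int[m]_(x in D) f x <= \int[m]_(x in D) g x)%E.
Proof.
move=> f0 fg; have g0 x : D x -> (0 <= g x)%E.
  by move=> Dx; apply: le_trans (fg x Dx); exact: f0.
rewrite integral_mkcond [leRHS]integral_mkcond.
rewrite !ge0_integralTE; [|by move=> x; exact: erestrict_ge0..].
apply: ereal_sup_le => _ [h hf <-]; exists h => // x.
apply: le_trans (hf x) _; rewrite !patchE.
by case: ifPn => // /set_mem; exact: fg.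
Qed.

Lemma integral_ge_cst d (T : measurableType d) (R : realType)
    (m : {measure set T -> \bar R}) (D A : set T) (f : T -> \bar R) (k : R) :
  measurable A -> A `<=` D -> 0 <= k -> (forall x, D x -> (0 <= f x)%E) ->
  (forall x, A x -> (k%:E <= f x)%E) ->
  (k%:E * m A <= \int[m]_(x in D) f x)%E.
Proof.
move=> mA AD k0 f0 fk; rewrite -integral_cst// integral_mkcond [leRHS]integral_mkcond.
apply: ge0_integral_le => x _; first by apply: erestrict_ge0 => y _; rewrite lee_fin.
rewrite !patchE; case: ifPn => [/set_mem Ax|_].
  by rewrite mem_set ?fk//; exact: AD.
by case: ifPn => // /set_mem /f0.
Qed.

Section curves.
Context {R : realType} {X : completeMetricType R}.

Lemma curve_lipschitz (c : curve X) a b : 0 <= a -> a <= b -> b <= curve_len c ->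
  mdist (c a) (c b) <= b - a.
Proof.
move=> a0 ab bl; have := curve_arclength a0 ab bl.
have [->|nab] := eqVneq a b; first by rewrite mdistxx subrr.
have ltab : a < b by rewrite lt_neqAle nab.
rewrite -lee_fin => <-; apply: ereal_sup_ubound; exists [:: b].
  exact: itv_partition1.
by rewrite big_nat1.
Qed.

(* The two extreme times at which [v] leaves [v 0] and reaches [v l] bound an
   interval on which [v] stays strictly between them. *)
Lemma lipschitz_crossing (v : R -> R) (l s : R) : 0 < s -> 0 <= l -> v 0 < v l ->
  (forall a b, 0 <= a -> a <= b -> b <= l -> `|v a - v b| <= (b - a) / s) ->
  exists a b, [/\ 0 <= a, a <= b, b <= l, s * (v l - v 0) <= b - a &
    forall t, a < t -> t < b -> v 0 < v t < v l].
Proof.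
move=> s0 l0 vl lip.
pose A := [set t | 0 <= t <= l /\ v t <= v 0].
have hA : has_sup A.
  split; first by exists 0; split; rewrite ?lexx.
  by exists l => t [/andP[]].
pose a := sup A.
have a0 : 0 <= a by apply: sup_upper_bound => //; split; rewrite ?lexx.
have al : a <= l by apply: ge_sup; [exact: hA.1|move=> t [/andP[]]].
(* The bound holds at members of [A] arbitrarily close to the supremum [a], and the Lipschitz
   estimate carries it over to [a]; [vb] is the mirror image. *)
have va : v a <= v 0.
  apply/ler_addgt0Pr => e e0.
  have es0 : 0 < e * s by rewrite mulr_gt0.
  have [t [/andP[t0 tl] vt] ht] := sup_adherent es0 hA.
  have ta : t <= a by apply: sup_upper_bound => //; split; rewrite ?t0.
  have := lip t a t0 ta al; have : (a - t) / s <= e.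
    by rewrite ler_pdivrMr//; rewrite -/a in ht; lra.
  by have := ler_norm (v a - v t); rewrite distrC; lra.
pose B := [set t | a <= t <= l /\ v l <= v t].
have hB : has_inf B.
  split; first by exists l; split; rewrite ?lexx ?al.
  by exists a => t [/andP[]].
pose b := inf B.
have bl : b <= l by apply: ge_inf; [exact: hB.2|split; rewrite ?lexx ?al].
have ab : a <= b by apply: lb_le_inf; [exact: hB.1|move=> t [/andP[]]].
have vb : v l <= v b.
  apply/ler_addgt0Pr => e e0.
  have es0 : 0 < e * s by rewrite mulr_gt0.
  have [t [/andP[t0 tl] vt] ht] := inf_adherent es0 hB.
  have bt : b <= t by apply: ge_inf; [exact: hB.2|split; rewrite ?t0].
  have := lip b t (le_trans a0 ab) bt tl; have : (t - b) / s <= e.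
    by rewrite ler_pdivrMr//; rewrite -/b in ht; lra.
  by have := ler_norm (v t - v b); rewrite distrC; lra.
exists a, b; split => //.
  have := lip a b a0 ab bl; rewrite distrC => h1.
  have : v l - v 0 <= (b - a) / s by have := ler_norm (v b - v a); lra.
  by rewrite ler_pdivlMr// mulrC.
move=> t at_ tb; apply/andP; split; rewrite ltNge; apply/negP => h.
  have : t <= a.
    apply: sup_upper_bound => //; split => //.
    by apply/andP; split; lra.
  lra.
have : b <= t.
  apply: ge_inf; first exact: hB.2.
  by split => //; apply/andP; split; lra.
lra.
Qed.

(** By [lipschitz_crossing], a change of [u] along a curve already takes place on a time interval
    where [u] is strictly between its end values, hence in the open unit interval. So the slope is
    needed only there. *)
Lemma lipschitz_upper_gradient (u : X -> R) (s : R) : 0 < s ->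
  (forall y, 0 <= u y <= 1) ->
  (forall y z, `|u y - u z| <= mdist y z / s) ->
  upper_gradient (EFin \o u)
    (fun y => (s^-1 * \1_[set z | 0 < u z < 1] y)%:E).
Proof.
move=> s0 u01 lu.
have cu : continuous u.
  apply: loc_lipschitz_continuous => x; exists 1 => //; exists s^-1 => y z _ _.
  by rewrite mulrC.
have g0 x : 0 <= s^-1 * \1_[set z | 0 < u z < 1] x :> R.
  by rewrite mulr_ge0// invr_ge0 ltW.
split.
- apply/measurable_EFinP; apply: measurable_funM => //.
  apply: measurable_indic; apply: sub_sigma_algebra.
  have -> : [set z | 0 < u z < 1] = u @^-1` `]0, 1[%classic.
    by apply/seteqP; split => z /=; rewrite in_itv.
  by move/continuousP : cu; apply; exact: interval_open.
- by move=> x; rewrite lee_fin.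
move=> c; have l0 := curve_len_ge0 c.
(* Stated for a general [v] so as to apply to [u] when it increases from start to end of the curve,
   and to [1 - u] when it decreases. *)
have main (v : X -> R) : (forall y, 0 <= v y <= 1) ->
    (forall y, (0 < v y < 1) -> (0 < u y < 1)) ->
    (forall y z, `|v y - v z| <= mdist y z / s) ->
    v (c 0) < v (c (curve_len c)) ->
    ((v (c (curve_len c)) - v (c 0))%:E <= curve_integral c
    (fun y => (s^-1 * \1_[set z | (0 < u z < 1)%R] y)%:E))%E.
  move=> v01 vu lv vlt.
  have [|a [b [a0 ab bl sab hv]]] :=
      @lipschitz_crossing (v \o c) (curve_len c) s s0 l0 vlt.
    move=> a b a0 ab bl; apply: le_trans (lv _ _) _.
    by apply: ler_wpM2r; [rewrite invr_ge0 ltW|exact: curve_lipschitz].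
  apply: (@le_trans _ _ ((s^-1)%:E * lebesgue_measure (`]a, b[%classic : set R))%E).
    rewrite lebesgue_measure_itv/= lte_fin; case: ltP => [ab'|ba].
      by rewrite -EFinD -EFinM lee_fin mulrC ler_pdivlMr// mulrC.
    by move: sab; rewrite /= mule0 lee_fin; nra.
  apply: integral_ge_cst => //.
  - move=> t /=; rewrite !in_itv/= => /andP[at_ tb].
    by apply/andP; split; lra.
  - by rewrite invr_ge0 ltW.
  - by move=> t _; rewrite lee_fin.
  move=> t /=; rewrite in_itv/= => /andP[at_ tb].
  rewrite lee_fin indicE mem_set ?mulr1//=; apply: vu.
  have /andP[h1 h2] := hv t at_ tb.
  have /andP[h3 _] := v01 (c 0); have /andP[_ h4] := v01 (c (curve_len c)).
  by move: h1 h2 => /= h1 h2; apply/andP; split; lra.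
have [uu|uu|uu] := ltgtP (u (c 0)) (u (c (curve_len c))).
- rewrite /= distrC ger0_norm ?subr_ge0 ?(ltW uu)//.
  exact: main.
- rewrite /= ger0_norm ?subr_ge0 ?(ltW uu)//.
  have -> : u (c 0) - u (c (curve_len c)) =
    (1 - u (c (curve_len c))) - (1 - u (c 0)) by ring.
  apply: (main (fun y => 1 - u y)).
  + by move=> y; have /andP[h1 h2] := u01 y; apply/andP; split; lra.
  + by move=> y /andP[h1 h2]; apply/andP; split; lra.
  + move=> y z; have -> : 1 - u y - (1 - u z) = - (u y - u z) by ring.
    by rewrite normrN.
  + lra.
- rewrite /= uu subrr normr0; apply: integral_ge0 => t _.
  by rewrite lee_fin.
Qed.

End curves.

(** * Refinement of mixed balls *)

Section truncated_distance.
Context {R : realType} {X : completeMetricType R}.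

(* The distance to [L] divided by [s] and truncated at 1; the constant 1 is also
   the value when [L] is empty. *)
Definition trunc_dist (L : set X) (s : R) (y : X) : R :=
  inf ([set 1] `|` [set mdist y z / s | z in L]).

Context (L : set X) (s : R) (s0 : 0 < s).

Let has_inf_td y : has_inf ([set 1] `|` [set mdist y z / s | z in L]).
Proof.
split; first by exists 1; left.
by exists 0 => _ [->//|[z _ <-]]; rewrite divr_ge0 ?mdist_ge0 ?ltW.
Qed.

Lemma trunc_dist_itv y : 0 <= trunc_dist L s y <= 1.
Proof.
apply/andP; split.
  apply: lb_le_inf; first exact: (has_inf_td y).1.
  by move=> _ [->//|[z _ <-]]; rewrite divr_ge0 ?mdist_ge0 ?ltW.
by apply: ge_inf; [exact: (has_inf_td y).2|left].
Qed.

Lemma trunc_dist_eq0 y : L y -> trunc_dist L s y = 0.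
Proof.
move=> Ly; apply/eqP; rewrite eq_le; have /andP[-> _] := trunc_dist_itv y.
rewrite andbT; apply: ge_inf; first exact: (has_inf_td y).2.
by right; exists y => //; rewrite mdistxx mul0r.
Qed.

Lemma trunc_dist_lt1 y : trunc_dist L s y < 1 -> exists2 z, L z & mdist y z < s.
Proof.
move=> /(inf_lt (has_inf_td y).1)[_ [->|[z Lz <-]]]; first by rewrite ltxx.
by rewrite ltr_pdivrMr// mul1r; exists z.
Qed.

Lemma trunc_dist_lipschitz y z :
  `|trunc_dist L s y - trunc_dist L s z| <= mdist y z / s.
Proof.
have main a b : trunc_dist L s a <= trunc_dist L s b + mdist a b / s.
  rewrite -lerBlDr; apply: lb_le_inf; first exact: (has_inf_td b).1.
  have d0 : 0 <= mdist a b / s by rewrite divr_ge0 ?mdist_ge0 ?ltW.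
  move=> _ [->|[w Lw <-]].
    by have /andP[_] := trunc_dist_itv a; lra.
  rewrite lerBlDr; apply: (@le_trans _ _ (mdist a w / s)).
    by apply: ge_inf; [exact: (has_inf_td a).2|right; exists w].
  rewrite -mulrDl ler_wpM2r ?invr_ge0 ?(ltW s0)// addrC.
  exact: metric_triangle.
rewrite ler_norml; have := main y z; have := main z y.
by rewrite (metric_sym z y) => h1 h2; apply/andP; split; lra.
Qed.

End truncated_distance.

Section refinement.
Context {R : realType} {X : completeMetricType R}.
Context (mu : {outer_measure set X -> \bar R}).
Context (mu_regular : borel_regular mu) (mu_doubling : doubling mu).
Context (E : set X) (E_perimeter : finite_perimeter mu E).
Context (C lambda : R) (C0 : 0 < C) (lambda1 : 1 <= lambda).
Context (mu_poincare : ball_poincare mu C lambda).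

Local Notation volB x r := (vol mu (ball x r)).
Local Notation volE x r := (vol mu (ball x r `&` E)).
Local Notation volC x r := (vol mu (ball x r `&` ~` E)).

Definition mixed (k : R) (x : X) (r : R) := k * volB x r <= mixture mu E x r.

Lemma mixedP k x r : mixed k x r <->
  k * volB x r <= volE x r /\ k * volB x r <= volC x r.
Proof. by rewrite /mixed /mixture le_min; split => [/andP|/andP]. Qed.

Lemma vol_split x r : volB x r = volE x r + volC x r.
Proof.
have [mE _] := E_perimeter; have := mE (ball x r).
rewrite !(vol_EFin mu_doubling (@subIsetl _ (ball x r) _)) (vol_ballE mu_doubling).
by rewrite -EFinD => -[].
Qed.

Lemma volI_le (F : set X) x y r s : mdist y x + r <= s ->
  vol mu (ball x r `&` F) <= vol mu (ball y s `&` F).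
Proof.
move=> h; apply: (le_vol mu_doubling (x := y) (r := s)); last exact: subIsetl.
by apply: setSI; exact: ball_subset.
Qed.

(** At scale [s] this set stands in for the complement of [E], and the truncated distance to it is a
    Lipschitz substitute for the indicator of [E]. *)
Definition lowset (s : R) := [set y | 2 * volE y s <= volB y s].

Definition transition (k : R) := forall (s : R) (y z : X), 0 < s ->
  ~ lowset s y -> lowset s z -> mdist y z < s -> mixed k y (2 * s).

(** [E] fills at least half of the ball around [y], its complement at least half of the one around
    [z]. Both balls lie in [ball y (2 * s)] and have comparable measure by doubling. *)
Lemma transition_ex : exists2 k : R, 0 < k & transition k.
Proof.
have [K K1 HK] := vol_ball_scale mu_doubling 4.
have K0 : 0 < K by lra.
exists (1 / (2 * K)); first by rewrite divr_gt0// mulr_gt0.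
move=> s y z s0 /negP; rewrite -ltNge => hy hz yz; apply/mixedP.
have hKy := HK y s s0; have hKz := HK z s s0.
have sy := vol_split z s.
have h1 : volB y (2 * s) <= volB y (4 * s).
  by apply: vol_ball_le; rewrite // mdistxx; lra.
have h2 : volB y (2 * s) <= volB z (4 * s).
  by apply: vol_ball_le; rewrite // metric_sym; lra.
have h3 : volE y s <= volE y (2 * s).
  by apply: volI_le; rewrite mdistxx; lra.
have h4 : volC z s <= volC y (2 * s).
  by apply: volI_le; lra.
have e v : 1 / (2 * K) * v = v / (2 * K) by rewrite mulrAC mul1r.
rewrite !e !ler_pdivrMr ?mulr_gt0//; rewrite /lowset/= in hz.
by split; nra.
Qed.

Definition deviation (s : R) : set X :=
  [set y | (E y /\ trunc_dist (lowset s) s y <> 1) \/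
           (~ E y /\ trunc_dist (lowset s) s y <> 0)].

(** On each ball [ball z s] of a net the deviation is controlled by the mixture of [ball z (4 * s)].
    Either this mixture is a fixed part of the volume, or one of [E] and its complement is so scarce
    that the truncated distance has the value of the other side throughout [ball z s], and only the
    scarce side deviates. Summing with [mixture_sum_bound] at radius [4 * s] gives the factor
    [s]. *)
Lemma deviation_le : exists2 M : R, 0 <= M & forall (x : X) (r s : R), 0 < s ->
  vol mu (ball x r `&` deviation s) <= M * s.
Proof.
have [M M0 HM] := mixture_sum_bound mu_regular mu_doubling E_perimeter C0 lambda1 mu_poincare.
have [N HN] := separated_size mu_regular mu_doubling (4 * lambda).
have [K K1 HK] := vol_ball_scale mu_doubling 8.
have K0 : 0 < K by lra.
exists (2 * K * 4 * (N%:R * M)); first by rewrite !mulr_ge0//; lra.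
move=> x r s s0.
have [l [ul lx sl hl]] :=
  maximal_net mu_regular mu_doubling s0 (@subset_refl _ (ball x r)).
have s40 : 0 < 4 * s by rewrite mulr_gt0.
have local z : vol mu (ball z s `&` deviation s) <= 2 * K * mixture mu E z (4 * s).
  have sub : ball z s `<=` ball z (4 * s).
    by apply: ball_subset; rewrite mdistxx; lra.
  have volK y : mdist z y < 2 * s -> volB z (4 * s) <= K * volB y s.
    move=> zy; apply: le_trans (HK y s s0).
    by apply: vol_ball_le; rewrite // metric_sym; lra.
  have [mixd|] := leP (volB z (4 * s)) (2 * K * mixture mu E z (4 * s)).
    apply: le_trans mixd; apply: (le_vol mu_doubling (x := z) (r := 4 * s)) => //.
    by move=> y [/sub].
  rewrite /mixture; set m := Num.min _ _ => mixd.
  have m0 : m <= 2 * K * m.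
    have : 0 <= m by rewrite le_min !vol_ge0.
    by nra.
  apply: le_trans m0.
  have [EC|CE] := leP (volE z (4 * s)) (volC z (4 * s)).
    have mE : m = volE z (4 * s) by rewrite /m; apply/min_idPl.
    rewrite mE; apply: (le_vol mu_doubling (x := z) (r := 4 * s)) => //; last first.
    move=> y [/[dup] /sub zy4 /ballP zy dev]; split => //.
    have Ly : lowset s y.
      have h1 : volE y s <= volE z (4 * s) by apply: volI_le; lra.
      have /volK : mdist z y < 2 * s by lra.
      rewrite mE in mixd; rewrite /lowset/= => h2; nra.
    by case: dev => [[]//|[_]]; rewrite trunc_dist_eq0.
  have mE : m = volC z (4 * s) by rewrite /m; apply/min_idPr; exact: ltW.
  rewrite mE; apply: (le_vol mu_doubling (x := z) (r := 4 * s)) => //; last first.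
  move=> y [/[dup] /sub zy4 /ballP zy dev]; split => //.
  (* A value below 1 would give a point [w] of [lowset] within [2 * s] of [z]; around it the
     complement of [E] would fill half a ball, against its scarcity. *)
  case: dev => [[_ u1]|[]//]; exfalso; apply: u1.
  have /andP[_] := trunc_dist_itv (lowset s) s0 y.
  rewrite le_eqVlt => /predU1P[//|/(trunc_dist_lt1 s0)[w Lw yw]].
  have zw := metric_triangle z y w.
  have h1 : volC w s <= volC z (4 * s) by apply: volI_le; lra.
  have /volK : mdist z w < 2 * s by lra.
  have := vol_split w s; rewrite mE in mixd; rewrite /lowset/= in Lw; nra.
apply: (@le_trans _ _ (\sum_(z <- l) vol mu (ball z s `&` deviation s))).
  rewrite -lee_fin -(vol_EFin mu_doubling (@subIsetl _ (ball x r) _)) -sumEFin.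
  under eq_bigr do rewrite -(vol_EFin mu_doubling (@subIsetl _ (ball _ s) _)).
  apply: outer_measure_seq_le => y [/hl[z zl zy] Dy]; exists z => //; split => //.
  exact/ballP.
apply: le_trans (ler_sum _ (fun z _ => local z)) _.
have := HM N [seq (z, 4 * s) | z <- l].
rewrite big_map/= -mulr_suml -mulr_sumr.
move=> h; have {h} : (\sum_(i <- l) mixture mu E i (4 * s)) / (4 * s) <= N%:R * M.
  apply: h; first by move=> p /mapP[z _ ->].
  move=> z; rewrite count_map -size_filter.
  apply: (HN z s) => //; first exact: filter_uniq.
    move=> w; rewrite mem_filter/= => /andP[/set_mem/ballP wz _].
    by rewrite metric_sym; move: wz => /=; lra.
  by move=> w w'; rewrite !mem_filter => /andP[_ wl] /andP[_ w'l]; exact: sl.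
rewrite ler_pdivrMr// => h; have K20 : 0 <= 2 * K by lra.
have := ler_wpM2l K20 h; lra.
Qed.

End refinement.

(** * Packings of mixed balls and their refinement *)

Section packings.
Context {R : realType} {X : completeMetricType R}.
Context (mu : {outer_measure set X -> \bar R}).
Context (mu_regular : borel_regular mu) (mu_doubling : doubling mu).
Context (E : set X) (E_perimeter : finite_perimeter mu E).
Context (C lambda : R) (C0 : 0 < C) (lambda1 : 1 <= lambda).
Context (mu_poincare : ball_poincare mu C lambda).
Context (k : R) (k0 : 0 < k) (k_transition : transition mu E k).

Local Notation volB x r := (vol mu (ball x r)).
Local Notation mixed := (mixed mu E).

(** The Poincare inequality is applied to the truncated distance [u] to [lowset]. On the mixed ball
    it oscillates as much as the indicator of [E], up to the small deviation set, and its gradient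
    [s^-1] lives on [Z]; so [Z] has measure at least of order [s * volB x r / r]. Points of [Z] lie
    outside [lowset] but within [s] of it, hence carry mixed balls by [transition], and a net of [Z]
    selects separated ones. *)
Lemma refine_ball : exists2 c : R, 0 < c & forall (x : X) (r : R), 0 < r -> mixed k x r ->
  exists2 s0 : R, 0 < s0 & forall s : R, 0 < s -> s <= s0 -> exists l : seq X,
  [/\ uniq l, forall y, y \in l -> mdist x y < lambda * r /\ mixed k y (2 * s),
      separated (4 * (lambda + 1) * s) l &
      c * (volB x r / r) <= \sum_(y <- l) volB y (2 * s) / (2 * s)].
Proof.
have l1 := lambda1.
have [K K1 HK] := vol_ball_scale mu_doubling (2 * (lambda + 1)).
have K0 : 0 < K by lra.
have [M M0 HM] := deviation_le mu_regular mu_doubling E_perimeter C0 lambda1 mu_poincare.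
exists (k / (4 * C * K)); first by rewrite divr_gt0// !mulr_gt0.
move=> x r r0 /mixedP[mE mC].
have v0 := vol_ball_gt0 mu_doubling x r0.
(* Below this scale the deviation set removes at most half of the guaranteed volume of [E] and of
   its complement; [M + 1] is positive even if [M] is 0. *)
exists (k * volB x r / (2 * (M + 1))).
  by rewrite divr_gt0 ?mulr_gt0//; lra.
move=> s s0 ss.
have L4 : 0 < 4 * (lambda + 1) * s by rewrite !mulr_gt0//; lra.
have Ms : M * s <= k * volB x r / 2.
  move: ss; rewrite ler_pdivlMr; last by lra.
  nra.
pose L := lowset mu E s; pose u := trunc_dist L s.
pose Z := [set z | 0 < u z < 1].
have u01 := trunc_dist_itv L s0.
have lu := trunc_dist_lipschitz L s0.
have llu : loc_lipschitz u.
  by move=> z; exists 1 => //; exists s^-1 => a b _ _; rewrite mulrC; exact: lu.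
have mu_ := borel_fun_cara mu_regular (continuous_borel_fun (loc_lipschitz_continuous llu)).
have mur : measurable_fun [set: caratheodory_type mu] (u : caratheodory_type mu -> R).
  by apply/measurable_EFinP.
have mF (B : set R) : measurable B -> mu.-caratheodory (u @^-1` B).
  by move=> mB; have := mur measurableT B mB; rewrite setTI.
have mZ : mu.-caratheodory Z.
  have -> : Z = u @^-1` `]0, 1[%classic.
    by apply/seteqP; split => z /=; rewrite in_itv.
  by apply: mF.
have m1 : mu.-caratheodory [set y | u y = 1] by apply: (mF [set 1]).
have m0 : mu.-caratheodory [set y | u y = 0] by apply: (mF [set 0]).
have subI F : ball x r `&` F `<=` ball x r by exact: subIsetl.
have half F (b : R) : (forall y, F y -> u y = b \/ deviation mu E s y) ->
    k * volB x r <= vol mu (ball x r `&` F) ->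
    k * volB x r / 2 <= vol mu (ball x r `&` [set y | u y = b]).
  move=> Fb kF.
  have : vol mu (ball x r `&` F) <= vol mu (ball x r `&` [set y | u y = b]) +
      vol mu (ball x r `&` deviation mu E s).
    rewrite -lee_fin EFinD -!(vol_EFin mu_doubling (subI _)).
    apply: le_trans (outer_measureU2 mu _ _); apply: le_outer_measure.
    by move=> y [By /Fb[uy|dy]]; [left|right].
  by have := HM x r s s0; lra.
have h1 : k * volB x r / 2 <= vol mu (ball x r `&` [set y | u y = 1]).
  apply: half mE => y Ey; have [->|/eqP u1] := eqVneq (u y) 1; first by left.
  by right; left.
have h0 : k * volB x r / 2 <= vol mu (ball x r `&` [set y | u y = 0]).
  apply: half mC => y Ey; have [->|/eqP u1] := eqVneq (u y) 0; first by left.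
  by right; right.
have ug := lipschitz_upper_gradient s0 u01 lu.
have [a ha] := mu_poincare x r0 (loc_lipschitz_L1loc mu_regular mu_doubling llu) ug.
have key : k * volB x r / 2 <= C * r * (s^-1 * vol mu (ball x (lambda * r) `&` Z)).
  rewrite -lee_fin.
  apply: (@le_trans _ _ (\int[cara_measure mu]_(y in ball x r) `|(EFin \o u) y - a|)%E).
    apply: le_trans (oscillation_ge mu_regular mu_doubling _ _ _ m1 m0 mu_ _ _).
    - by rewrite lee_fin le_min h1 h0.
    - by move=> y /= ->.
    - by move=> y /= ->.
  apply: le_trans ha _; rewrite [leRHS]EFinM; apply: lee_wpmul2l.
    by rewrite lee_fin mulr_ge0// ltW.
  under eq_integral do rewrite EFinM.
  rewrite ge0_integralZl_EFin//.
  - rewrite integral_indic//; last exact: cara_measurable_ball.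
    by rewrite setIC /= (vol_EFin mu_doubling (@subIsetl _ (ball x (lambda * r)) Z)).
  - exact: cara_measurable_ball.
  - apply/measurable_EFinP; apply: measurable_funTS; exact: measurable_indic.
  - by rewrite invr_ge0 ltW.
(* The net parameter [4 * (lambda + 1) * s] is the separation that [packing] demands of two balls of
   radius [2 * s]. *)
have [l [ul lS sl hl]] :=
  maximal_net mu_regular mu_doubling L4 (@subIsetl _ (ball x (lambda * r)) Z).
exists l; split => //.
  move=> y /lS[/ballP xy /andP[u0 u1]]; split => //.
  have [z Lz yz] := trunc_dist_lt1 s0 u1.
  apply: (k_transition s0 _ Lz yz) => Ly.
  by move: u0; rewrite [u y]trunc_dist_eq0 ?ltxx.
have cover : vol mu (ball x (lambda * r) `&` Z) <= K * \sum_(y <- l) volB y (2 * s).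
  rewrite -lee_fin -(vol_EFin mu_doubling (@subIsetl _ (ball x (lambda * r)) _)).
  apply: (@le_trans _ _ (\sum_(y <- l) mu (ball y (2 * (lambda + 1) * (2 * s))))%E).
    apply: outer_measure_seq_le => y /hl[z zl zy]; exists z => //.
    by apply/ballP; lra.
  rewrite mulr_sumr -sumEFin; apply: lee_sum => y _.
  by rewrite (vol_ballE mu_doubling) lee_fin; apply: HK; lra.
rewrite -mulr_suml; set S := \sum_(y <- l) _ in cover *.
have {}key : k * volB x r / 2 <= C * r * (s^-1 * (K * S)).
  apply: le_trans key _; rewrite ler_wpM2l ?mulr_ge0 ?(ltW r0) ?(ltW C0)//.
  by rewrite ler_wpM2l// invr_ge0 ltW.
have -> : k / (4 * C * K) * (volB x r / r) = (k * volB x r / 2) / (2 * C * K * r).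
  by field; rewrite !gt_eqF.
rewrite ler_pdivrMr ?mulr_gt0//.
have -> : S / (2 * s) * (2 * C * K * r) = C * r * (s^-1 * (K * S)).
  by field; rewrite gt_eqF.
exact: key.
Qed.

Lemma mixed_shift (tau : R) : exists2 k1 : R, 0 < k1 &
  forall (y z : X) (s : R), 0 < s -> mixed k y s -> mdist z y < tau * s ->
    mixed k1 z ((tau + 1) * s).
Proof.
have [K K1 HK] := vol_ball_scale mu_doubling (2 * tau + 1).
have K0 : 0 < K by lra.
exists (k / K); first exact: divr_gt0.
move=> y z s s0 /mixedP[mE mC] zy.
have h : volB z ((tau + 1) * s) <= K * volB y s.
  apply: le_trans (HK y s s0); apply: vol_ball_le => //.
  by rewrite metric_sym; lra.
have kh : k / K * volB z ((tau + 1) * s) <= k * volB y s.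
  rewrite mulrAC ler_pdivrMr// -mulrA; apply: ler_wpM2l; first exact: ltW k0.
  by rewrite [leRHS]mulrC.
by apply/mixedP; split; apply: le_trans kh _;
  [apply: le_trans mE _|apply: le_trans mC _]; apply: volI_le => //; lra.
Qed.

(** The factor [lambda + 1] makes the [lambda]-dilated balls disjoint and leaves a gap of
    [p.2 + q.2] between them, which keeps refinements of different balls apart. *)
Definition packing (P : seq (X * R)) :=
  [/\ uniq P, forall p, p \in P -> 0 < p.2 /\ mixed k p.1 p.2 &
      forall p q, p \in P -> q \in P -> p != q ->
        (lambda + 1) * (p.2 + q.2) <= mdist p.1 q.1].

(** The sum that defines the Hausdorff content of codimension one. *)
Definition weight (P : seq (X * R)) := \sum_(p <- P) volB p.1 p.2 / p.2.

(** The dilated balls are disjoint, so [mixture_sum_bound] applies with overlap 1, and mixed balls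
    have volume at most [mixture / k]. *)
Lemma packing_bound : exists2 W : R, 0 <= W & forall P, packing P -> weight P <= W.
Proof.
have l1 := lambda1.
have [M M0 HM] := mixture_sum_bound mu_regular mu_doubling E_perimeter C0 lambda1 mu_poincare.
exists (M / k); first by rewrite divr_ge0// ltW.
move=> P [uP mP dP].
have h : \sum_(p <- P) mixture mu E p.1 p.2 / p.2 <= 1%N%:R * M.
  apply: HM; first by move=> p /mP[].
  move=> z; case: (P) uP mP dP => [//|p0 P0] uP mP dP.
  rewrite -size_filter leqNgt; apply/negP.
  set Q := [seq _ <- _ | _] => Q1.
  have uQ : uniq Q by exact: filter_uniq.
  pose p := nth p0 Q 0; pose q := nth p0 Q 1.
  have : p \in Q by apply: mem_nth; exact: ltnW Q1.
  have : q \in Q by apply: mem_nth.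
  have pq : p != q by rewrite nth_uniq// ltnW.
  rewrite !mem_filter => /andP[/set_mem/ballP zq qP] /andP[/set_mem/ballP zp pP].
  have := dP p q pP qP pq.
  have := metric_triangle p.1 z q.1; rewrite metric_sym in zq *.
  rewrite metric_sym in zq.
  have [p20 _] := mP p pP; have [q20 _] := mP q qP.
  nra.
rewrite mul1r in h; rewrite ler_pdivlMr// (le_trans _ h)// /weight mulr_suml.
rewrite big_seq [leRHS]big_seq; apply: ler_sum => p pP.
have [p20 mp] := mP p pP.
rewrite mulrAC ler_pM2r ?invr_gt0// mulrC; exact: mp.
Qed.

Lemma packing_cat P Q : packing P -> packing Q ->
  (forall p q, p \in P -> q \in Q ->
     (lambda + 1) * (p.2 + q.2) <= mdist p.1 q.1) -> packing (P ++ Q).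
Proof.
have l1 := lambda1.
move=> [uP mP dP] [uQ mQ dQ] dPQ; split.
- rewrite cat_uniq uP uQ andbT/=; apply/hasPn => q qQ; apply/negP => qP.
  have := dPQ q q qP qQ; rewrite mdistxx; have [q20 _] := mQ q qQ; nra.
- by move=> p; rewrite mem_cat => /orP[/mP|/mQ].
- move=> p q; rewrite !mem_cat => /orP[pP|pQ] /orP[qP|qQ] pq.
  + exact: dP.
  + exact: dPQ.
  + by rewrite metric_sym [p.2 + _]addrC dPQ.
  + exact: dQ.
Qed.

Lemma weight_cat P Q : weight (P ++ Q) = weight P + weight Q.
Proof. exact: big_cat. Qed.

Lemma refine_packing : exists2 c : R, 0 < c & forall P, packing P ->
  exists2 s0 : R, 0 < s0 & forall s : R, 0 < s -> s <= s0 ->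
  exists P', [/\ packing P',
    forall q, q \in P' -> q.2 = 2 * s /\
      exists2 p, p \in P & mdist p.1 q.1 < lambda * p.2 &
    c * weight P <= weight P'].
Proof.
have l1 := lambda1.
have L4 : 0 < 4 * (lambda + 1) by lra.
have [c c0 Hc] := refine_ball; exists c => //; elim=> [|p P IH].
  move=> _; exists 1 => // s _ _; exists [::]; split => //.
  by rewrite /weight !big_nil mulr0.
move=> [/= /andP[pP uP] mP dP].
have inP q : q \in P -> q \in p :: P by move=> qP; rewrite inE qP orbT.
have [|s1 s10 H1] := IH.
  split => // [q /inP/mP//|q q' /inP qP /inP q'P].
  exact: dP.
have [p20 mp] := mP p (mem_head _ _).
have [s2 s20 H2] := Hc p.1 p.2 p20 mp.
(* The last term makes the required separation [4 * (lambda + 1) * s] at most [p.2], which fits into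
   the gap between [p] and the other balls. *)
exists (Num.min (Num.min s1 s2) (p.2 / (4 * (lambda + 1)))).
  by rewrite !lt_min s10 s20 divr_gt0.
move=> s s0; rewrite !le_min => /andP[/andP[ss1 ss2]].
rewrite ler_pdivlMr// => sp2.
have [Q [pQ cQ wQ]] := H1 s s0 ss1.
have [l [ul ml sl wl]] := H2 s s0 ss2.
have pl : packing [seq (y, 2 * s) | y <- l].
  split.
  - by rewrite map_inj_uniq// => y y' [].
  - by move=> q /mapP[y yl ->] /=; split; [lra|exact: (ml y yl).2].
  - move=> q q' /mapP[y yl ->] /mapP[y' y'l ->] /= yy'.
    have yny : y != y' by apply: contraNneq yy' => ->.
    by have := sl y y' yl y'l yny; lra.
exists ([seq (y, 2 * s) | y <- l] ++ Q); split.
- apply: packing_cat => // q q' /mapP[y yl ->] q'Q /=.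
  have [-> [p' p'P pq']] := cQ q' q'Q.
  have [py _] := ml y yl.
  have pp' : p != p' by apply: contraNneq pP => ->.
  have := dP p p' (mem_head _ _) (inP _ p'P) pp'.
  have [p'20 _] := mP p' (inP _ p'P).
  have := metric_triangle p.1 y p'.1; have := metric_triangle y q'.1 p'.1.
  by rewrite (metric_sym q'.1); lra.
- move=> q; rewrite mem_cat => /orP[/mapP[y yl ->]|qQ] /=.
    by split => //; exists p; [exact: mem_head|exact: (ml y yl).1].
  have [q2 [p' p'P pq']] := cQ q qQ; split => //.
  by exists p' => //; exact: inP.
- rewrite weight_cat /weight big_cons mulrDr big_map; exact: lerD.
Qed.

Definition small (A : set X) (eta : R) := exists2 d : R, 0 < d &
  forall P, packing P -> (forall p, p \in P -> A p.1 /\ p.2 < d) ->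
    weight P <= eta.

Definition nbd (F : set X) (d : R) := [set y | exists2 z, F z & mdist z y < d].

(* If arbitrarily thin neighbourhoods of [F] were not small, then refining
   their packings twice would produce, in disjoint annuli around [F], packings
   of weight bounded below at all small scales; this contradicts
   [packing_bound]. *)
Lemma small_nbd : exists2 k1 : R, 0 < k1 & forall (F : set X) (d0 : R), 0 < d0 ->
  (forall (z : X) (r : R), F z -> 0 < r -> r < d0 -> ~ mixed k1 z r) ->
  forall eta : R, 0 < eta -> exists2 d : R, 0 < d & small (nbd F d) eta.
Proof.
have l1 := lambda1.
have [k1 k10 Hk1] := mixed_shift (2 * (lambda + 1)).
have [c c0 Hc] := refine_packing.
have [W W0 HW] := packing_bound.
exists k1 => // F d0 d00 HF eta eta0; apply: contrapT => nsmall.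
have big (D d : R) : 0 < D -> 0 < d -> exists P, [/\ packing P,
    forall p, p \in P -> nbd F D p.1 /\ p.2 < d & eta <= weight P].
  move=> D0 d_0; apply: contrapT => h; apply: nsmall; exists D => //.
  exists d => // P pP hP; rewrite leNgt; apply/negP => /ltW wP.
  by apply: h; exists P.
pose annulus n D e := forall d : R, 0 < d -> exists P, [/\ packing P,
    forall p, p \in P -> [/\ nbd F D p.1, ~ nbd F e p.1 & p.2 < d] &
    n%:R * (c * (c * eta)) <= weight P].
have ann1 D : 0 < D -> exists2 e, 0 < e < D & annulus 1%N D e.
  move=> D0.
  have [|//|P0 [pP0 cP0 wP0]] := big (D / 2) (D / (4 * lambda)).
  - by rewrite divr_gt0.
  - by rewrite divr_gt0// mulr_gt0//; lra.
  have [s1 s10 H1] := Hc P0 pP0.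
  (* The bound by [D] keeps both refinements inside the [D]-neighbourhood; the bound by [d0] puts
     the radius produced by [mixed_shift] in the range where [HF] forbids mixed balls. *)
  pose s := Num.min (Num.min s1 (D / (16 * (lambda + 1)))) (d0 / (8 * (lambda + 2))).
  have s0 : 0 < s by rewrite !lt_min s10 !divr_gt0//; lra.
  have [ss1 sD sd] : [/\ s <= s1, s <= D / (16 * (lambda + 1)) &
      s <= d0 / (8 * (lambda + 2))].
    by split; rewrite /s !ge_min lexx ?orbT.
  rewrite ler_pdivlMr in sD; last lra.
  rewrite ler_pdivlMr in sd; last lra.
  have [P1 [pP1 cP1 wP1]] := H1 s s0 ss1.
  have [s2 s20 H2] := Hc P1 pP1.
  (* The first refinement fixes the inner radius of the annulus: a point of [F] this close to a ball
     of the second refinement would itself carry a mixed ball. The second refinement then reaches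
     every small scale [d]. *)
  exists (2 * s); first by apply/andP; split; nra.
  move=> d d_0.
  pose s' := Num.min s2 (d / 4).
  have s'0 : 0 < s' by rewrite lt_min s20 divr_gt0.
  have ss'2 : s' <= s2 by rewrite ge_min lexx.
  have [P2 [pP2 cP2 wP2]] := H2 s' s'0 ss'2.
  exists P2; split => //; last first.
    rewrite mul1r; apply: le_trans wP2; rewrite ler_pM2l//.
    by apply: le_trans wP1; rewrite ler_pM2l.
  move=> q /cP2[q2 [p pP1' pq]].
  have [p2 [p0 p0P p0p]] := cP1 p pP1'.
  have [[z Fz zp0] p02] := cP0 p0 p0P.
  rewrite ltr_pdivlMr in p02; last lra.
  rewrite p2 in pq.
  split.
  - exists z => //.
    have := metric_triangle z p0.1 q.1; have := metric_triangle p0.1 p.1 q.1.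
    nra.
  - move=> [w Fw wq].
    have [_ mP1 _] := pP1; have [p20 mp] := mP1 p pP1'.
    rewrite p2 in p20 mp.
    have wp := metric_triangle w q.1 p.1; rewrite (metric_sym q.1) in wp.
    apply: (HF w _ Fw _ _ (Hk1 p.1 w (2 * s) p20 mp _)).
    + by rewrite mulr_gt0//; lra.
    + nra.
    + nra.
  - rewrite q2; have : s' <= d / 4 by rewrite ge_min lexx orbT.
    lra.
have annn n : forall D, 0 < D -> exists2 e, 0 < e < D & annulus n D e.
  elim: n => [|n IH] D D0.
    exists (D / 2); first by apply/andP; split; lra.
    move=> d d_0; exists [::]; split => //.
    by rewrite /weight big_nil mul0r.
  have [e1 /andP[e10 e1D] A1] := ann1 D D0.
  (* The further annuli stay within [e1 / 2] of [F] while the first one is at least [e1] away, so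
     balls of radius below [e1 / (4 * (lambda + 1))] in them form a packing together. *)
  have [|e /andP[e0 ee1] An] := IH (e1 / 2); first lra.
  exists e; first by apply/andP; split; lra.
  move=> d d_0.
  have e1l : 0 < e1 / (4 * (lambda + 1)) by rewrite divr_gt0//; lra.
  have d'0 : 0 < Num.min d (e1 / (4 * (lambda + 1))) by rewrite lt_min d_0.
  have [P [pP cP wP]] := A1 _ d'0.
  have [Q [pQ cQ wQ]] := An _ d'0.
  exists (P ++ Q); split.
  - apply: packing_cat => // p q /cP[_ np +] /cQ[[z Fz zq] _ +].
    rewrite !lt_min !ltr_pdivlMr; [|lra|lra] => /andP[_ p2] /andP[_ q2].
    have zp : e1 <= mdist z p.1.
      by rewrite leNgt; apply/negP => h; apply: np; exists z.
    have := metric_triangle z q.1 p.1; rewrite (metric_sym q.1).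
    lra.
  - move=> p; rewrite mem_cat.
    move=> /orP[/cP[h1 h2]|/cQ[[z Fz zp] h2]]; rewrite lt_min => /andP[h3 _].
      split => //; move=> [z Fz zp]; apply: h2; exists z => //; lra.
    by split => //; exists z => //; lra.
  - rewrite weight_cat -natr1 mulrDl addrC; exact: lerD.
have : 0 <= W / (c * (c * eta)) by rewrite divr_ge0// !mulr_ge0// ltW.
move=> /archi_boundP; set n := Num.bound _ => Wn.
have [e _ /(_ 1 ltr01)[P [pP _ wP]]] := annn n 1 ltr01.
have := HW P pP; move: Wn; rewrite ltr_pdivrMr ?mulr_gt0// => Wn.
lra.
Qed.

End packings.

(** * Coverings and test functions *)

Section densities.
Context {R : realType} {X : completeMetricType R}.
Context (mu : {outer_measure set X -> \bar R}).
Context (mu_regular : borel_regular mu).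
Local Open Scope ereal_scope.

Lemma series_density (h : nat -> X -> \bar R) (S : \bar R) :
  (forall n, borel_fun (h n)) -> (forall n x, 0 <= h n x) ->
  (forall N, \sum_(0 <= n < N) \int[cara_measure mu]_x h n x <= S) ->
  exists rho : X -> \bar R, [/\ borel_fun rho, forall x, 0 <= rho x,
    \int[cara_measure mu]_x rho x <= S & forall n x, h n x <= rho x].
Proof.
move=> bh h0 hS; exists (fun x => \sum_(n <oo) h n x); split.
- apply: (@ge0_emeasurable_sum _ _ _ _ (h : nat -> borel_type -> \bar R) xpredT).
    by move=> n x _ _; exact: h0.
  by move=> n _; exact: bh.
- by move=> x; apply: nneseries_ge0 => n _ _; exact: h0.
- rewrite integral_nneseries//; last first.
    by move=> n; apply: borel_fun_cara => //; exact: bh.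
  apply: lime_le; last by apply: nearW => N; exact: hS.
  by apply: is_cvg_nneseries => n _ _; exact: integral_ge0.
- move=> n x; apply: le_trans (nneseries_lim_ge n.+1 _); last by move=> *; exact: h0.
  by rewrite big_nat_recr//= leeDr// sume_ge0.
Qed.

End densities.

Section vitali.
Context {R : realType} {X : completeMetricType R}.
Context (L : R) (L0 : 0 < L).

Definition far (p q : X * R) := L * (p.2 + q.2) <= mdist p.1 q.1.

(** Zorn's lemma is applied to far-apart subfamilies in which every member of [G] not far from the
    subfamily is dominated by one of its members. If some member of [G] were far from a maximal such
    [V], one could add to [V] an [m] whose radius exceeds half the supremum over all members far
    from [V]. *)
Lemma vitali (G : set (X * R)) (d : R) : (forall p, G p -> 0 < p.2 < d) ->
  exists V, [/\ V `<=` G, forall p q, V p -> V q -> p <> q -> far p q &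
    forall p, G p -> exists2 q, V q & ~ far p q /\ p.2 <= 2 * q.2].
Proof.
move=> G0.
pose P (V : set (X * R)) := [/\ V `<=` G,
  forall p q, V p -> V q -> p <> q -> far p q &
  forall p q, G p -> V q -> ~ far p q ->
    exists2 q', V q' & ~ far p q' /\ p.2 <= 2 * q'.2].
have [F PF totF|V [[VG Vfar Vbig] Vmax]] := @Zorn_bigcup _ P.
  split.
  - by move=> p [V /PF[VG _ _]]; exact: VG.
  - move=> p q [V FV Vp] [W FW Wq] pq.
    have [VW|WV] := totF V W FV FW.
      by have [_ Wfar _] := PF W FW; apply: Wfar => //; exact: VW.
    by have [_ Vfar _] := PF V FV; apply: Vfar => //; exact: WV.
  - move=> p q Gp [V FV Vq] npq; have [_ _ Vbig] := PF V FV.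
    by have [q' Vq' hq'] := Vbig p q Gp Vq npq; exists q' => //; exists V.
exists V; split => // p Gp.
have [[q Vq npq]|allfar] := pselect (exists2 q, V q & ~ far p q).
  exact: Vbig npq.
exfalso.
pose G' := [set p | G p /\ forall q, V q -> far p q].
have G'p : G' p.
  by split => // q Vq; apply: contrapT => npq; apply: allfar; exists q.
have hs : has_sup [set q.2 | q in G'].
  split; first by exists p.2; exists p.
  by exists d => _ [q [/G0/andP[_ /ltW qd] _] <-].
have p0 : 0 < p.2 by have /andP[] := G0 p Gp.
have sup0 : 0 < sup [set q.2 | q in G'].
  by apply: lt_le_trans p0 _; apply: sup_upper_bound => //; exists p.
have hs2 : 0 < sup [set q.2 | q in G'] / 2 by rewrite divr_gt0.
have [_ [m [Gm mfar] <-] hm] := sup_adherent hs2 hs.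
have m0 : 0 < m.2 by have /andP[] := G0 m Gm.
have nfm : ~ far m m by apply/negP; rewrite /far mdistxx -ltNge mulr_gt0// addr_gt0.
apply: (Vmax (V `|` [set m])).
  split; first exact: subsetUl.
  by move=> h; apply: nfm; apply: mfar; apply: h; right.
split.
- by move=> q [/VG//|->].
- move=> q q' [Vq|->] [Vq'|->] qq' //.
  + exact: Vfar.
  + by have := mfar q Vq; rewrite /far metric_sym [q.2 + _]addrC.
  + exact: mfar.
- move=> q q' Gq Vq' nqq'.
  have [[w Vw nqw]|qfar] := pselect (exists2 w, V w & ~ far q w).
    by have [w' Vw' hw'] := Vbig q w Gq Vw nqw; exists w' => //; left.
  have G'q : G' q.
    by split => // w Vw; apply: contrapT => nqw; apply: qfar; exists w.
  exists m; first by right.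
  split.
    case: Vq' nqq' => [Vq'|->//] nqq'.
    by exfalso; apply: qfar; exists q'.
  have : q.2 <= sup [set q.2 | q in G'] by apply: sup_upper_bound => //; exists q.
  by move: hm; lra.
Qed.

End vitali.

Lemma countable_bounded_sums {R : realType} (T : choiceType) (V : set T) (w : T -> R)
    (S : R) : (forall p, V p -> 0 < w p) ->
  (forall l : seq T, uniq l -> (forall p, p \in l -> V p) -> \sum_(p <- l) w p <= S) ->
  countable V.
Proof.
move=> w0 wS.
have -> : V = \bigcup_(n in setT) [set p | V p /\ n.+1%:R^-1 <= w p].
  apply/seteqP; split => [p Vp|p [n _ []//]].
  have wi : 0 <= (w p)^-1 by rewrite invr_ge0 ltW// w0.
  exists (Num.bound (w p)^-1) => //; split => //.
  rewrite -[leRHS]invrK lef_pV2 ?posrE ?invr_gt0 ?w0//.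
  by apply: ltW; apply: lt_trans (archi_boundP wi) _; rewrite ltr_nat.
apply: bigcup_countable => // n _; apply: finite_set_countable.
apply: contrapT => inf.
have n0 : 0 < n.+1%:R :> R by [].
have S0 : 0 <= S by have := wS [::]; rewrite big_nil; apply.
have Sn : 0 <= S * n.+1%:R by rewrite mulr_ge0.
have [B BV cB] := infinite_set_fset (Num.bound (S * n.+1%:R)) inf.
have BVp p : p \in finmap.enum_fset B -> V p /\ n.+1%:R^-1 <= w p by move=> pB; exact: BV.
have := wS (finmap.enum_fset B) (finmap.fset_uniq B) (fun p pB => (BVp p pB).1).
apply/negP; rewrite -ltNge.
apply: (@lt_le_trans _ _ (\sum_(p <- finmap.enum_fset B) n.+1%:R^-1)).
  rewrite big_const_seq count_predT iter_addr_0 -[(_ *+ _)]mulr_natl ltr_pdivlMr//.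
  by apply: lt_le_trans (archi_boundP Sn) _; rewrite ler_nat.
by rewrite big_seq [leRHS]big_seq; apply: ler_sum => p /BVp[].
Qed.

Section packing_density.
Context {R : realType} {X : completeMetricType R}.
Context (mu : {outer_measure set X -> \bar R}).
Context (mu_regular : borel_regular mu) (mu_doubling : doubling mu).
Context (E : set X) (lambda : R) (lambda1 : 1 <= lambda) (k : R).

Local Notation Lam := (lambda + 1).

(** A curve at least [h] long spends time [h] within distance [h] of [c t], hence where [rho] is at
    least [h^-1]. The time interval starts at [t], or is the final one of length [h] if [t] is too
    near the end. *)
Lemma curve_integral_ge1 (c : curve X) (rho : X -> \bar R) (q : X * R) (h t : R) :
  (forall x, 0 <= rho x)%E -> 0 < h -> h <= curve_len c ->
  0 <= t <= curve_len c -> mdist (c t) q.1 < h ->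
  (forall x, mdist q.1 x < 2 * h -> ((h^-1)%:E <= rho x)%E) ->
  (1 <= curve_integral c rho)%E.
Proof.
move=> rho0 h0 hl /andP[t0 tl] ctq rhoq.
have [a [a0 al ta at_]] : exists a : R, [/\ 0 <= a, a + h <= curve_len c,
    t - h <= a & a <= t].
  have [thl|lth] := leP (t + h) (curve_len c).
    by exists t; split => //; lra.
  by exists (curve_len c - h); split; lra.
have -> : (1 = (h^-1)%:E * lebesgue_measure (`]a, (a + h)%R[%classic : set R))%E.
  rewrite lebesgue_measure_itv/= lte_fin ltrDl h0 -EFinD -EFinM addrAC subrr add0r.
  by rewrite mulVf// gt_eqF.
apply: integral_ge_cst => //.
- by move=> s /=; rewrite !in_itv/= => /andP[? ?]; apply/andP; split; lra.
- by rewrite invr_ge0 ltW.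
move=> s /=; rewrite in_itv/= => /andP[as_ sa]; apply: rhoq.
have : mdist (c t) (c s) < h.
  have [ts|st] := leP t s.
    by have := @curve_lipschitz _ _ c t s t0 ts; lra.
  have s0 : 0 <= s by lra.
  by rewrite metric_sym; have := @curve_lipschitz _ _ c s t s0 (ltW st) tl; lra.
by have := metric_triangle q.1 (c t) (c s); rewrite (metric_sym q.1 (c t)); lra.
Qed.

(** [rho] adds up, over a Vitali subfamily [V], the value [(3 * Lam * q.2)^-1] on the ball of radius
    [6 * Lam * q.2]. A mixed ball at [c t] is not far from some [q] in [V] with [r <= 2 * q.2], so
    [c t] is within [3 * Lam * q.2] of [q.1] and [curve_integral_ge1] applies. *)
Lemma packing_density : exists2 K : R, 0 <= K &
  forall (A : set X) (eta d : R), 0 < d ->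
  (forall P, packing mu E lambda k P -> (forall p, p \in P -> A p.1 /\ p.2 < d) ->
    weight mu P <= eta) ->
  exists rho : X -> \bar R, [/\ borel_fun rho, forall x, (0 <= rho x)%E,
    (\int[cara_measure mu]_x rho x <= (K * eta)%:E)%E &
    forall (c : curve X) (t r : R), 0 <= t <= curve_len c ->
      3 * Lam * d <= curve_len c -> A (c t) -> 0 < r < d ->
      mixed mu E k (c t) r -> (1 <= curve_integral c rho)%E].
Proof.
have l1 := lambda1.
have La0 : 0 < Lam by lra.
have [K K1 HK] := vol_ball_scale mu_doubling (6 * Lam).
exists K; first lra.
move=> A eta d d0 Hw.
pose G := [set p : X * R | [/\ A p.1, 0 < p.2 < d & mixed mu E k p.1 p.2]].
have [|V [VG Vfar Vbig]] := @vitali _ _ Lam La0 G d; first by move=> p [].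
have Vpack l : uniq l -> (forall p, p \in l -> V p) -> weight mu l <= eta.
  move=> ul lV; apply: Hw.
    split => //.
    - by move=> p /lV/VG[_ /andP[]].
    - by move=> p q pl ql /eqP; apply: Vfar; exact: lV.
  by move=> p /lV/VG[? /andP[]].
have V2 p : V p -> 0 < p.2 by move=> /VG[_ /andP[]].
have cV : countable V.
  apply: (@countable_bounded_sums R _ V (fun p => vol mu (ball p.1 p.2) / p.2) eta).
    by move=> p Vp; rewrite divr_gt0 ?V2//; apply: vol_ball_gt0 => //; exact: V2.
  exact: Vpack.
have /countable_injP[f finj] := cV.
(* [e] inverts the injection [f] of [V] into the naturals, and [b] marks its range; outside it [e n]
   is a default value and [h n] is 0. *)
pose e n := xget (point, 0) [set p | V p /\ f p = n].
pose b n := `[< V (e n) /\ f (e n) = n >].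
have eP p : V p -> e (f p) = p /\ b (f p).
  move=> Vp; have : [set q | V q /\ f q = f p] (e (f p)) by apply: (@xgetI _ _ _ p).
  move=> [Ve fe]; split; last exact/asboolP.
  by apply: finj => //; exact: mem_set.
pose h n (x : X) : \bar R := if b n then
  ((3 * Lam * (e n).2)^-1 * \1_(ball (e n).1 (6 * Lam * (e n).2)) x)%:E else 0%E.
have e2 n : b n -> 0 < (e n).2 by move=> /asboolP[Ve _]; exact: V2.
have h3 n : b n -> 0 < 3 * Lam * (e n).2 by move=> /e2 e0; rewrite !mulr_gt0.
have bh n : borel_fun (h n).
  rewrite /h /borel_fun; case: (boolP (b n)) => bn /=; last exact: measurable_cst.
  apply/measurable_EFinP; apply: measurable_funM => //; apply: measurable_indic.
  by apply: sub_sigma_algebra; exact: open_metric_ball.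
have h0 n x : (0 <= h n x)%E.
  rewrite /h; case: ifPn => // bn; rewrite lee_fin mulr_ge0// invr_ge0 ltW//.
  exact: h3.
have hI n : (\int[cara_measure mu]_x h n x <=
    if b n then (K * (vol mu (ball (e n).1 (e n).2) / (e n).2))%:E else 0)%E.
  rewrite /h; case: (boolP (b n)) => bn /=; last by rewrite integral0.
  under eq_integral do rewrite EFinM.
  have e0 := e2 n bn.
  rewrite ge0_integralZl_EFin//; last 2 first.
  - apply/measurable_EFinP; apply: measurable_indic; exact: cara_measurable_ball.
  - by rewrite invr_ge0 ltW// h3.
  rewrite integral_indic//; last exact: cara_measurable_ball.
  rewrite setIT /= (vol_ballE mu_doubling) -EFinM lee_fin.
  rewrite mulrA mulrC ler_pM ?vol_ge0 ?invr_ge0 ?(ltW (h3 n bn))//.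
    exact: HK.
  by rewrite lef_pV2 ?posrE ?h3//; nra.
have hS N : (\sum_(0 <= n < N) \int[cara_measure mu]_x h n x <= (K * eta)%:E)%E.
  apply: le_trans (lee_sum _ (fun n _ => hI n)) _.
  rewrite -big_mkcond/= sumEFin lee_fin -mulr_sumr ler_wpM2l//; first lra.
  have := Vpack [seq e n | n <- iota 0 N & b n].
  rewrite /weight big_map big_filter /index_iota subn0; apply.
    rewrite map_inj_in_uniq ?filter_uniq ?iota_uniq// => n m.
    rewrite !mem_filter => /andP[/asboolP[_ fn] _] /andP[/asboolP[_ fm] _] em.
    by rewrite -fn -fm em.
  by move=> p /mapP[n]; rewrite mem_filter => /andP[/asboolP[Ve _] _] ->.
have [rho [brho rho0 Irho hrho]] := series_density mu_regular bh h0 hS.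
exists rho; split => // c t r tc ld Ac rd mr.
have [q Vq [/negP nfar r2]] := Vbig (c t, r) (And3 Ac rd mr).
have [eq bq] := eP q Vq.
have q0 := V2 q Vq; have [_ /andP[_ qd] _] := VG q Vq.
rewrite /far -ltNge/= in nfar; rewrite /= in r2.
apply: (@curve_integral_ge1 c rho q (3 * Lam * q.2) t) => //.
- by rewrite !mulr_gt0.
- by apply: le_trans ld; rewrite ler_pM2l ?mulr_gt0// ltW.
- by apply: lt_le_trans nfar _; nra.
move=> x qx; apply: le_trans (hrho (f q) x); rewrite /h bq eq lee_fin.
rewrite indicE mem_set ?mulr1//; apply/ballP.
by move: qx; rewrite mulrA mulrA -natrM.
Qed.

End packing_density.

(** * Curves crossing from the interior to the exterior *)

Section crossing.
Context {R : realType} {X : completeMetricType R}.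
Context (mu : {outer_measure set X -> \bar R}).
Context (mu_regular : borel_regular mu) (mu_doubling : doubling mu).
Context (E : set X) (E_perimeter : finite_perimeter mu E).

(** The time interval is cut into [N] steps shorter than [s]. Membership in [lowset] changes across
    some step, whose end points are less than [s] apart, so [transition] yields a mixed ball. *)
Lemma crossing_mixed (k : R) (c : curve X) (t0 t1 s : R) : transition mu E k ->
  0 <= t0 -> t0 < t1 -> t1 <= curve_len c -> 0 < s ->
  ~ (lowset mu E s (c t0) <-> lowset mu E s (c t1)) ->
  exists2 t, t0 <= t <= t1 & mixed mu E k (c t) (2 * s).
Proof.
move=> tk t00 t01 t1l s0 flip; apply: contrapT => nomix.
have same a b : t0 <= a -> a <= b -> b <= t1 -> b - a < s ->
    lowset mu E s (c a) <-> lowset mu E s (c b).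
  move=> ta ab bt bas.
  have cab : mdist (c a) (c b) < s.
    apply: le_lt_trans bas; apply: curve_lipschitz => //; lra.
  split=> h; apply: contrapT => nh; apply: nomix.
    exists b; first by apply/andP; split; lra.
    by apply: (tk s _ (c a)) => //; rewrite metric_sym.
  exists a; first by apply/andP; split; lra.
  exact: (tk s _ (c b)).
have w0 : 0 <= (t1 - t0) / s by rewrite divr_ge0//; lra.
have := archi_boundP w0; set N := Num.bound _ => hN.
have N0 : 0 < N%:R :> R by apply: le_lt_trans hN.
pose tau (i : nat) := t0 + (t1 - t0) / N%:R * i%:R.
have dt : 0 < (t1 - t0) / N%:R by rewrite divr_gt0//; lra.
have tauN : tau N = t1 by rewrite /tau divfK ?gt_eqF//; lra.
have taule i : (i <= N)%N -> tau i <= t1.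
  by move=> iN; rewrite -tauN lerD2l ler_wpM2l ?(ltW dt)// ler_nat.
have ind i : (i <= N)%N -> lowset mu E s (c t0) <-> lowset mu E s (c (tau i)).
  elim: i => [_|i IH iN]; first by rewrite /tau mulr0 addr0.
  apply: (iff_trans (IH (ltnW iN))); apply: same.
  - by rewrite lerDl mulr_ge0// ltW.
  - by rewrite lerD2l ler_wpM2l ?(ltW dt)// ler_nat.
  - exact: taule.
  - have -> : tau i.+1 - tau i = (t1 - t0) / N%:R by rewrite /tau -natr1; ring.
    by move: hN; rewrite ltr_pdivrMr// ltr_pdivrMr// mulrC.
by apply: flip; rewrite -tauN; exact: ind.
Qed.

Lemma at_right_exists (P : set R) : (0%R^'+ : set_system R) P ->
  exists2 r0, 0 < r0 & forall r, 0 < r -> r < r0 -> P r.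
Proof.
move=> /nbhs_ballP[r0 /= r00 h]; exists r0 => // r rp rr0; apply: h => //.
by rewrite /ball/= sub0r normrN gtr0_norm.
Qed.

Lemma density_ratioE (F : set X) (x : X) (r : R) : 0 < r ->
  density_ratio mu F x r = (vol mu (ball x r `&` F) / vol mu (ball x r))%:E.
Proof.
move=> r0; rewrite /density_ratio (vol_ballE mu_doubling).
rewrite (vol_EFin mu_doubling (@subIsetl _ (ball x r) F)) inver.
by rewrite gt_eqF// vol_ball_gt0.
Qed.

Lemma meas_interior_high (x : X) : meas_interior mu E x ->
  exists2 r0 : R, 0 < r0 & forall r, 0 < r -> r < r0 -> ~ lowset mu E r x.
Proof.
move=> hx.
have : nbhs (1%E : \bar R) [set y : \bar R | ((1 / 2 : R)%:E < y)%E].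
  apply: open_nbhs_nbhs; split; first exact: open_ereal_gt_ereal.
  by rewrite /= lte_fin; lra.
move=> /hx/at_right_exists[r0 r00 h]; exists r0 => // r rp rr0.
have := h r rp rr0; rewrite /= density_ratioE// lte_fin.
rewrite ltr_pdivlMr ?vol_ball_gt0// /lowset/= => h1; lra.
Qed.

Lemma meas_exterior_low (x : X) : meas_exterior mu E x ->
  exists2 r0 : R, 0 < r0 & forall r, 0 < r -> r < r0 -> lowset mu E r x.
Proof.
move=> hx.
have : nbhs (0%E : \bar R) [set y : \bar R | (y < (1 / 2 : R)%:E)%E].
  apply: open_nbhs_nbhs; split; first exact: open_ereal_lt_ereal.
  by rewrite /= lte_fin; lra.
move=> /hx/at_right_exists[r0 r00 h]; exists r0 => // r rp rr0.
have := h r rp rr0; rewrite /= density_ratioE// lte_fin.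
rewrite ltr_pdivrMr ?vol_ball_gt0// /lowset/= => h1; lra.
Qed.

Lemma upper_density0 (F : set X) (x : X) (k : R) : 0 < k ->
  ~ (0 < upper_density mu F x)%E ->
  exists2 r0 : R, 0 < r0 & forall r, 0 < r -> r < r0 ->
    vol mu (ball x r `&` F) < k * vol mu (ball x r).
Proof.
move=> k0 /negP; rewrite -leNgt => h.
have {h} : (upper_density mu F x < k%:E)%E by apply: le_lt_trans h _; rewrite lte_fin.
move=> /ereal_inf_lt[_ [A hA <-] Ak].
have [r0 r00 h] := at_right_exists hA; exists r0 => // r rp rr0.
have Ar : A r by exact: h.
have : (density_ratio mu F x r < k%:E)%E.
  by apply: le_lt_trans Ak; apply: ereal_sup_ubound; exists r.
by rewrite density_ratioE// lte_fin ltr_pdivrMr ?vol_ball_gt0.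
Qed.

Lemma not_meas_boundary (x : X) (k : R) : 0 < k -> ~ meas_boundary mu E x ->
  exists2 r0 : R, 0 < r0 & forall r, 0 < r -> r < r0 -> ~ mixed mu E k x r.
Proof.
move=> k0 /not_andP[] /(upper_density0 k0)[r0 r00 h]; exists r0 => // r rp rr0;
  by move=> /mixedP[]; have := h r rp rr0; lra.
Qed.

End crossing.

(** * Assembly of the test function *)

Theorem corollary6p4 (R : realType) (X : completeMetricType R)
  (mu : {outer_measure set X -> \bar R})
  (mu_regular : borel_regular mu) (mu_doubling : doubling mu)
  (mu_poincare : poincare mu)
  (E : set X) (E_perimeter : finite_perimeter mu E) :
  modulus1 mu [set c : curve X | exists t0 t1 : R,
    [/\ 0 <= t0, t0 < t1, t1 <= curve_len c &
      [/\ meas_interior mu E (c t0), meas_exterior mu E (c t1) &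
          c @` `[t0, t1] `&` meas_boundary mu E = set0] \/
      [/\ meas_exterior mu E (c t0), meas_interior mu E (c t1) &
          c @` `[t0, t1] `&` meas_boundary mu E = set0]]] = 0%E.
Proof.
have [C [lambda [C0 lambda1 HP]]] := poincare_ball mu_doubling mu_poincare.
have [k k0 tk] := transition_ex mu_doubling E_perimeter.
have [k1 k10 Hsmall] := small_nbd mu_regular mu_doubling E_perimeter C0 lambda1 HP k0 tk.
have [K K0 HK] := packing_density mu_regular mu_doubling E lambda1 k.
apply/eqP; rewrite eq_le; apply/andP; split; last first.
  by apply: le_ereal_inf_tmp => _ [rho [_ rho0 _] <-]; exact: integral_ge0.
apply/lee_addgt0Pr => eps eps0; rewrite add0e.
have inv_gt0 (m : nat) : 0 < m.+1%:R^-1 :> R by rewrite invr_gt0.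
pose F (m : nat) : set X :=
  [set z | forall r, 0 < r -> r < m.+1%:R^-1 -> ~ mixed mu E k1 z r].
(* With these bounds the integrals, at most [K * eta m], sum to at most [eps]. *)
pose eta (m : nat) := eps / (K + 1) / 2 ^+ m.+1.
have eta0 m : 0 < eta m by rewrite !divr_gt0 ?exprn_gt0//; lra.
have /choice[d Hd] : forall m, exists d : R, 0 < d /\
    small mu E lambda k (nbd (F m) d) (eta m).
  move=> m.
  have [d d0 sd] := Hsmall (F m) _ (inv_gt0 m) (fun z r Fz => Fz r) (eta m) (eta0 m).
  by exists d.
(* The second condition lets [packing_density] apply to every curve of length at least
   [m.+1%:R^-1]. *)
have /choice[D HD] : forall m, exists D : R, [/\ 0 < D,
    3 * (lambda + 1) * D <= m.+1%:R^-1 &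
    forall P, packing mu E lambda k P ->
      (forall p, p \in P -> nbd (F m) (d m) p.1 /\ p.2 < D) -> weight mu P <= eta m].
  move=> m; have [_ [e e0 he]] := Hd m.
  have l3 : 0 < 3 * (lambda + 1) by lra.
  exists (Num.min e (m.+1%:R^-1 / (3 * (lambda + 1)))); split.
  - by rewrite lt_min e0 divr_gt0.
  - by rewrite mulrC -ler_pdivlMr// ge_min lexx orbT.
  - move=> P pP hP; apply: he => // p /hP[? ]; by rewrite lt_min => /andP[].
have /choice[rho_ Hrho] : forall m, exists rho : X -> \bar R,
    [/\ borel_fun rho, forall x, (0 <= rho x)%E,
    (\int[cara_measure mu]_x rho x <= (K * eta m)%:E)%E &
    forall (c : curve X) (t r : R), 0 <= t <= curve_len c ->
      m.+1%:R^-1 <= curve_len c -> nbd (F m) (d m) (c t) -> 0 < r < D m ->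
      mixed mu E k (c t) r -> (1 <= curve_integral c rho)%E].
  move=> m; have [D0 Dm HDm] := HD m.
  have [rho [h1 h2 h3 h4]] := HK _ _ _ D0 HDm.
  exists rho; split => // c t r tc mc; apply: h4 => //; exact: le_trans mc.
have Isum N : (\sum_(0 <= m < N) \int[cara_measure mu]_x rho_ m x <= eps%:E)%E.
  apply: (@le_trans _ _ (\sum_(0 <= m < N) (K * eta m)%:E)%E).
    by apply: lee_sum => m _; case: (Hrho m).
  rewrite sumEFin lee_fin.
  have geo : \sum_(0 <= m < N) eta m = eps / (K + 1) * (1 - 2^-1 ^+ N).
    elim: N => [|N IH]; first by rewrite big_nil expr0 subrr mulr0.
    rewrite big_nat_recr//= IH /eta exprS exprSr invfM exprVn; field.
    by rewrite expf_neq0//= gt_eqF//; lra.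
  rewrite -mulr_sumr geo.
  have h2 : 0 <= 2^-1 ^+ N :> R by rewrite exprn_ge0.
  have q0 : 0 < eps / (K + 1) by rewrite divr_gt0//; lra.
  have qe : eps / (K + 1) * (K + 1) = eps by rewrite divfK// gt_eqF//; lra.
  have : 0 <= K * (eps / (K + 1)) * 2^-1 ^+ N.
    by apply: mulr_ge0 => //; apply: mulr_ge0 => //; exact: ltW.
  by nra.
have [rho [brho rho0 Irho hrho]] := series_density mu_regular
  (fun m => let: And4 h _ _ _ := Hrho m in h)
  (fun m => let: And4 _ h _ _ := Hrho m in h) Isum.
apply: le_trans Irho; apply: ereal_inf_lbound; exists rho => //; split => //.
move=> c [t0 [t1 [t00 t01 t1l cross]]].
have [nobd [r0 r00 hflip]] : c @` `[t0, t1] `&` meas_boundary mu E = set0 /\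
    exists2 r0 : R, 0 < r0 & forall r, 0 < r -> r < r0 ->
      ~ (lowset mu E r (c t0) <-> lowset mu E r (c t1)).
  by case: cross => [[/(meas_interior_high mu_doubling)[a a0 ha]
      /(meas_exterior_low mu_doubling)[b b0 hb] ->]|
    [/(meas_exterior_low mu_doubling)[b b0 hb]
      /(meas_interior_high mu_doubling)[a a0 ha] ->]]; split => //;
  exists (Num.min a b); rewrite ?lt_min ?a0// => r rp; rewrite lt_min => /andP[ra rb] [h1 h2];
  have := ha r rp ra; have := hb r rp rb; tauto.
(* From index [m0] on, the curve is long enough for [rho_ m]. *)
pose m0 := Num.bound (t1 - t0)^-1.
have m0l : m0.+1%:R^-1 <= curve_len c.
  have w0 : 0 <= (t1 - t0)^-1 by rewrite invr_ge0; lra.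
  apply: (@le_trans _ _ (t1 - t0)); last lra.
  rewrite -[leRHS]invrK lef_pV2 ?posrE ?invr_gt0//; last lra.
  by apply: ltW; apply: lt_trans (archi_boundP w0) _; rewrite ltr_nat.
pose Q (n : nat) (t : R) := exists m, [/\ (m0 <= m)%N, (m <= n)%N &
  nbd (F m) (d m) (c t)].
(* Off the measure-theoretic boundary each [c t] lies in some [F m] with [m >= m0]; compactness of
   the time interval leaves finitely many neighbourhoods. *)
have [n hn] : exists n, forall t, `[t0, t1]%classic t -> Q n t.
  suff : \forall n \near \oo, `[t0, t1]%classic `<=` [set t | t0 <= t <= t1 -> Q n t].
    move=> [n _ /(_ n (leqnn n)) h]; exists n => t tt.
    by apply: (h t tt); move: tt; rewrite /= in_itv.
  apply: (compact_near_coveringP _).1 => [|t].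
    exact: segment_compact.
  rewrite /= in_itv/= => /andP[tt0 tt1].
  have nb : ~ meas_boundary mu E (c t).
    move=> bt; have : (c @` `[t0, t1] `&` meas_boundary mu E) (c t).
      by split => //; exists t => //; rewrite /= in_itv/= tt0.
    by rewrite nobd.
  have [r rp hr] := not_meas_boundary mu_doubling k10 nb.
  pose m := maxn m0 (Num.bound r^-1).
  have Fm : F m (c t).
    move=> r' r'0 r'm; apply: hr => //; apply: lt_le_trans r'm _.
    have r'i : 0 <= r^-1 by rewrite invr_ge0 ltW.
    rewrite -[leRHS]invrK lef_pV2 ?posrE ?invr_gt0//.
    apply: ltW; apply: lt_le_trans (archi_boundP r'i) _.
    by rewrite ler_nat; apply: leq_trans (leqnSn _); exact: leq_maxr.
  have [dm0 _] := Hd m.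
  exists (ball t (d m), [set n | (m <= n)%N]) => /=.
    by split; [exact: nbhsx_ballx|exists m].
  move=> [t' n] /= [tt' mn] /andP[t'0 t'1]; exists m; split => //.
    exact: leq_maxl.
  exists (c t) => //.
  move: tt'; rewrite /ball/= => tt'.
  have [le|lt] := leP t t'.
    apply: le_lt_trans (curve_lipschitz _ le _) _; [lra|lra|].
    by have := ler_norm (t' - t); rewrite distrC; lra.
  rewrite metric_sym; apply: le_lt_trans (curve_lipschitz _ (ltW lt) _) _; [lra|lra|].
  by have := ler_norm (t - t'); lra.
have [r1 r10 hr1] : exists2 r1 : R, 0 < r1 & forall m, (m <= n)%N -> r1 <= D m.
  elim: n {hn} => [|n [r1 r10 h]].
    by exists (D 0%N); [case: (HD 0%N)|move=> m; rewrite leqn0 => /eqP ->].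
  exists (Num.min r1 (D n.+1)); first by rewrite lt_min r10; case: (HD n.+1).
  move=> m; rewrite leq_eqVlt => /predU1P[->|mn]; first by rewrite ge_min lexx orbT.
  by rewrite ge_min h.
(* Small enough that [lowset] separates [c t0] from [c t1] at scale [s], and that the resulting
   mixed ball of radius [2 * s] is below every [D m] with [m <= n]. *)
pose s := Num.min r0 r1 / 4.
have [s0 sr0 sr1] : [/\ 0 < s, s < r0 & 2 * s < r1].
  have m_gt0 : 0 < Num.min r0 r1 by rewrite lt_min r00.
  have ml0 : Num.min r0 r1 <= r0 by rewrite ge_min lexx.
  have ml1 : Num.min r0 r1 <= r1 by rewrite ge_min lexx orbT.
  by rewrite /s; split; lra.
have [t tt mt] := crossing_mixed tk t00 t01 t1l s0 (hflip s s0 sr0).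
have [m [m0m mn hm]] : Q n t by apply: hn; rewrite /= in_itv.
have [_ _ _ H] := Hrho m.
apply: (@le_trans _ _ (curve_integral c (rho_ m))); last first.
  by apply: ge0_integral_le => u _ //; case: (Hrho m).
have /andP[tt0 tt1] := tt.
apply: (H c t (2 * s)) => //.
- by apply/andP; split; lra.
- by apply: le_trans m0l; rewrite lef_pV2 ?posrE// ler_nat.
- by apply/andP; split; [lra|apply: lt_le_trans sr1 _; exact: hr1].
Qed.
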